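(* Let $q\ge 2$. The Neretin group $N_q$ is simple (as an abstract group).
   Context: A tree is $q$-regular if every vertex has degree $q+1$; in a rooted $q$-regular tree, instead, the root has degree $q$ and all other vertices have degree $q+1$. Let $T$ be a $q$-regular tree. The boundary $\partial T$ is the set of ends of $T$, i.e. classes of rays (infinite sequences of distinct, consecutively adjacent vertices) modulo agreeing after removal of finite initial segments, with its usual compact topology (induced by the metric $d_o(\xi,\eta)=e^{-(\xi,\eta)_o}$, where $o$ is a base vertex and $(\xi,\eta)_o$ is the length of the common initial segment of the rays from $o$ representing $\xi,\eta$). A finite $q$-regular subtree $F\subseteq T$ is a finite subtree each of whose vertices has degree (in $F$) either $1$ (a leaf) or $q+1$ (an internal vertex). For such a nonempty $F$, $T\setminus F$ denotes the forest of rooted $q$-regular trees obtained from $T$ by removing all edges and all internal vertices of $F$, with the leaves of $F$ as roots. Its boundary (the disjoint union of the boundaries of its component trees) is identified with $\partial T$. An isomorphism of (rooted) forests $\phi\colon T\setminus F_1\to T\setminus F_2$, with $F_1,F_2$ finite $q$-regular subtrees, induces a homeomorphism $\phi_*$ of $\partial T$, called a spheromorphism. The Neretin group $N_q$ is the group of all spheromorphisms of $\partial T$ under composition. *)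

(* Defs.v *)
From HB Require Import structures.
From mathcomp Require Import all_boot finmap.
From mathcomp Require Import boolp classical_sets functions cardinality.

Set Implicit Arguments.
Unset Strict Implicit.
Unset Printing Implicit Defensive.

Local Open Scope classical_set_scope.
Local Open Scope card_scope.
Local Open Scope quotient_scope.

Section Simple.
Local Open Scope group_scope.

Definition normal_subgroup (G : groupType) (K : set G) : Prop :=
  group_closed [in K] /\ (forall x g : G, K x -> K (x ^ g)).

Definition simple_group (G : groupType) : Prop :=
  (exists x : G, x <> 1) /\
  (forall K : set G, normal_subgroup K -> K = [set 1] \/ K = setT).

End Simple.

(* [vertex0] is needed: the empty graph satisfies the other axioms.         *)
Record regular_tree (q : nat) := RegularTree {
  vertex :> choiceType;
  adj : rel vertex;
  vertex0 : inhabited vertex;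
  adj_sym : symmetric adj;
  adj_irr : irreflexive adj;
  adj_connected : forall x y : vertex, exists p, path adj x p /\ last x p = y;
  adj_acyclic : forall c : seq vertex, ucycle adj c -> size c <= 2;
  adj_regular : forall x : vertex, [set y | adj x y] #= `I_q.+1 }.

Section Neretin.
Variables (q : nat) (T : regular_tree q).
Local Notation adj := (@adj q T).
Implicit Types (x y z : T) (F A B : set T).

Record ray := Ray {
  ray_fun :> nat -> T;
  ray_inj : injective ray_fun;
  ray_adj : forall n, adj (ray_fun n) (ray_fun n.+1) }.

HB.instance Definition _ := gen_eqMixin ray.
HB.instance Definition _ := gen_choiceMixin ray.

Definition cofinal (r s : ray) : bool :=
  `[< exists m n, forall k, r (m + k) = s (n + k) >].

Lemma cofinal_refl : reflexive cofinal.
Proof. by move=> r; apply/asboolP; exists 0, 0. Qed.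

Lemma cofinal_sym : symmetric cofinal.
Proof.
by move=> r s; apply/asboolP/asboolP => -[m [n e]]; exists n, m => k; rewrite e.
Qed.

Lemma cofinal_trans : transitive cofinal.
Proof.
move=> s r t /asboolP[m [n e]] /asboolP[m' [n' e']]; apply/asboolP.
exists (m + m'), (n' + n) => k.
by rewrite -addnA e addnCA e' addnA.
Qed.

Canonical cofinal_equiv :=
  EquivRel cofinal cofinal_refl cofinal_sym cofinal_trans.

Definition ends := {eq_quot cofinal_equiv}.
HB.instance Definition _ := Choice.on ends.
HB.instance Definition _ := EqQuotient.on ends.

Definition end_of (r : ray) : ends := \pi_ends r.

(* A subtree of a tree is the subgraph induced on its vertex set, so it is  *)
(* encoded by that set.                                                     *)
Definition has_degree F x (d : nat) : Prop := [set y | F y /\ adj x y] #= `I_d.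

Definition leaf F x : Prop := F x /\ has_degree F x 1.
Definition internal F x : Prop := F x /\ has_degree F x q.+1.

Definition induced_connected F : Prop := forall x y, F x -> F y ->
  exists p, [/\ path adj x p, last x p = y & {in p, forall z, F z}].

Definition finite_regular_subtree F : Prop :=
  [/\ finite_set F, F !=set0, induced_connected F &
      forall x, F x -> leaf F x \/ internal F x].

(* The vertices and edges of the forest $T \setminus F$; its roots are the  *)
(* leaves of $F$.                                                           *)
Definition forest F : set T := [set x | ~ internal F x].
Definition forest_adj F x y : Prop := adj x y /\ ~ (F x /\ F y).

(* Only the restriction of [phi] to [forest F1] is relevant.                *)
Definition forest_iso F1 F2 (phi : T -> T) : Prop :=
  [/\ set_bij (forest F1) (forest F2) phi,
      forall x y, forest F1 x -> forest F1 y ->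
        (forest_adj F2 (phi x) (phi y) <-> forest_adj F1 x y) &
      forall x, forest F1 x -> (leaf F2 (phi x) <-> leaf F1 x)].

Definition forest_ray F (r : ray) : Prop :=
  forall n, forest F (r n) /\ forest_adj F (r n) (r n.+1).

(* [f] is $\phi_*$: it maps the class of every ray of $T \setminus F_1$ to  *)
(* the class of its image. Every end is the class of such a ray             *)
(* ([end_forest_ray]), so this determines [f].                              *)
Definition induces F1 (phi : T -> T) (f : ends -> ends) : Prop :=
  forall r, forest_ray F1 r ->
    exists2 s : ray, (forall n, s n = phi (r n)) & f (end_of r) = end_of s.

Definition induced_by_iso F1 F2 (f : ends -> ends) : Prop :=
  exists phi, forest_iso F1 F2 phi /\ induces F1 phi f.

(* No continuity condition is needed: such an [f] is a homeomorphism of the *)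
(* boundary.                                                                *)
Definition spheromorphism (f : ends -> ends) : Prop :=
  exists F1 F2, [/\ finite_regular_subtree F1, finite_regular_subtree F2 &
                    induced_by_iso F1 F2 f].

Lemma end_of_eq r s : end_of r = end_of s <->
  exists m n, forall k, r (m + k) = s (n + k).
Proof.
split=> [|h]; last by apply/eqquotP/asboolP.
by move=> /eqquotP/asboolP.
Qed.

Lemma endP (e : ends) : exists r, e = end_of r.
Proof. by exists (repr e); rewrite /end_of reprK. Qed.

Lemma card_eq_sub_fin A B n : A `<=` B -> A #= `I_n -> B #= `I_n -> A = B.
Proof.
move=> AB An Bn.
have fA : finite_set A by exists n.
have fB : finite_set B by exists n.
rewrite -(fset_setK fA) -(fset_setK fB).
suff -> : fset_set A = fset_set B by [].
apply/eqP; rewrite eqEfcard; apply/andP; split.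
  apply/fsubsetP => x; rewrite !in_fset_set// !inE; exact: AB.
by rewrite (card_fset_set An) (card_fset_set Bn).
Qed.

Lemma card_eq1P A : A #= `I_1 <-> exists x, A = [set x].
Proof.
split=> [/eq_cardSP[x Ax]|[x ->]]; last exact: card_set1.
rewrite II0 card_eq0 => /eqP e; exists x; apply/seteqP; split=> y; last by move->.
move=> Ay; apply: contrapT => xy; suff : set0 y by [].
by rewrite -e; split.
Qed.

Lemma bij_card A B (f : T -> T) : set_bij A B f -> A #= B.
Proof. by move=> h; apply: (pcard_eq h). Qed.

Lemma finite_nbr x : finite_set [set y | adj x y].
Proof. by exists q.+1; exact: adj_regular. Qed.

Lemma internal_nbr F x y : internal F x -> adj x y -> F y.
Proof.
move=> [_ d] xy.
have e : [set y | F y /\ adj x y] = [set y | adj x y].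
  by apply: card_eq_sub_fin d (adj_regular x) => z [].
have : [set y | adj x y] y by [].
by rewrite -e => -[].
Qed.

Lemma internalI F x : F x -> (forall y, adj x y -> F y) -> internal F x.
Proof.
move=> Fx h; split=> //; rewrite /has_degree.
rewrite (_ : mkset _ = [set y | adj x y]); first exact: adj_regular.
by apply/seteqP; split=> y /= => [[]//|xy]; split=> //; exact: h.
Qed.

Lemma forestN F x : ~ F x -> forest F x.
Proof. by move=> nF [/nF]. Qed.

Lemma forest_leaf F x : finite_regular_subtree F -> forest F x -> F x -> leaf F x.
Proof. by move=> [_ _ _ h] fx /h[]. Qed.

Lemma adj_sym' x y : adj x y -> adj y x.
Proof. by rewrite adj_sym. Qed.

Lemma unique_nbr F x y z : induced_connected F -> F x -> F z -> ~ F y ->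
  adj x y -> adj z y -> x = z.
Proof.
move=> cF Fx Fz nFy xy zy; have [p [xp lp pF]] := cF _ _ Fx Fz.
case: (shortenP xp) lp => p' xp' up' sp' lp.
have := @adj_acyclic q T (y :: x :: p').
case: p' xp' up' sp' lp => [//|a p'] xp' up' sp' lp; suff h : ucycle adj [:: y, x, a & p'] by move=> /(_ h).
apply/andP; split.
  move: xp'; rewrite /= rcons_path => /andP[-> ->] /=.
  by rewrite (adj_sym' xy) /=; move: zy; rewrite -lp.
rewrite cons_uniq up' andbT; apply/negP; rewrite inE => /orP[/eqP yx|].
  by apply: nFy; rewrite yx.
by move=> /sp'/pF.
Qed.

Lemma no_triangle x y z : adj x y -> adj x z -> adj y z -> False.
Proof.
move=> xy xz yz; have := @adj_acyclic q T [:: x; y; z].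
have ne a b : adj a b -> a != b by apply: contraTneq => ->; rewrite adj_irr.
suff h : ucycle adj [:: x; y; z] by move/(_ h).
by rewrite /ucycle /= xy yz adj_sym xz /= !inE negb_or !ne.
Qed.

Lemma con_sym F x y p : path adj x p -> last x p = y -> {in p, forall z, F z} ->
  F x -> exists p', [/\ path adj y p', last y p' = x & {in p', forall z, F z}].
Proof.
move=> xp lp pF Fx; exists (rev (belast x p)).
have e : path adj y (rev (belast x p)).
  rewrite -lp rev_path; apply: sub_path xp => a b; exact: adj_sym'.
split=> //.
  by case: p lp {xp pF e} => [//|a p] /= <-; rewrite rev_cons last_rcons.
by move=> z; rewrite mem_rev => /mem_belast; rewrite inE => /orP[/eqP->|/pF].
Qed.

Lemma con_hub F x : F x -> (forall y, F y -> exists p,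
   [/\ path adj y p, last y p = x & {in p, forall z, F z}]) -> induced_connected F.
Proof.
move=> Fx h y z Fy Fz; have [p [yp lp pF]] := h _ Fy.
have [s [zs ls sF]] := h _ Fz; have [s' [xs' ls' s'F]] := con_sym zs ls sF Fz.
exists (p ++ s'); split; first by rewrite cat_path yp lp.
  by rewrite last_cat lp.
by move=> a; rewrite mem_cat => /orP[/pF|/s'F].
Qed.

Lemma expand F x : finite_regular_subtree F -> leaf F x ->
  finite_regular_subtree (F `|` [set y | adj x y]).
Proof.
move=> [fF F0 cF dF] [Fx _]; set G := F `|` _.
have Gx : G x by left.
have new y : adj x y -> ~ F y -> leaf G y.
  move=> xy nFy; split; first by right.
  apply/card_eq1P; exists x; apply/seteqP; split=> z /=.
    move=> [[Fz|/= xz] yz].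
      by apply: esym; apply: unique_nbr cF Fx Fz nFy xy (adj_sym' yz).
    by case: (no_triangle xy xz yz).
  by move=> ->; split=> //; exact: adj_sym'.
split.
- by rewrite finite_setU; split=> //; exact: finite_nbr.
- by exists x.
- apply: (con_hub Gx) => y [Fy|xy].
    by have [p [? ? pF]] := cF _ _ Fy Fx; exists p; split=> // z /pF; left.
  exists [:: x]; split=> //=; first by rewrite andbT adj_sym.
  by move=> z; rewrite inE => /eqP ->.
- move=> y Gy; have [->|yx] := eqVneq y x.
    by right; apply: internalI => // z; right.
  have [Fy|nFy] := pselect (F y); last by left; case: Gy => // /new; apply.
  have e : [set z | G z /\ adj y z] = [set z | F z /\ adj y z].
    apply/seteqP; split=> z /= [Fz yz]; split=> //; last by left.
    case: Fz => // xz; apply: contrapT => nFz.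
    by move/eqP: yx; apply; exact: unique_nbr cF Fy Fx nFz yz xz.
  by rewrite /leaf /internal /has_degree e; case: (dF _ Fy) => -[]; [left|right].
Qed.

Lemma absorb F x : finite_regular_subtree F ->
  exists G, [/\ finite_regular_subtree G, F `<=` G & G x].
Proof.
move=> rF; have [_ [o Fo] _ _] := rF; have [p [op lp]] := adj_connected o x.
elim: p F o rF Fo op lp => [|y p IH] F o rF Fo /=; first by move=> _ <-; exists F; split.
move=> /andP[oy yp] lp.
have [G [rG FG Gy]] : exists G, [/\ finite_regular_subtree G, F `<=` G & G y].
  have [_ _ _ /(_ _ Fo)[lo|io]] := rF; last first.
    by exists F; split; [| |exact: internal_nbr io oy].
  by exists (F `|` [set y | adj o y]); split; [exact: expand|left|right].
have [H [rH GH Hx]] := IH _ _ rG Gy yp lp.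
by exists H; split=> //; exact: subset_trans GH.
Qed.

Lemma absorb_fin F A : finite_regular_subtree F -> finite_set A ->
  exists G, [/\ finite_regular_subtree G, F `<=` G & A `<=` G].
Proof.
move=> rF /finite_seqP[s ->]; elim: s => [|x s [G [rG FG sG]]].
  by exists F; split=> // ?.
have [H [rH GH Hx]] := absorb x rG; exists H; split=> //.
  exact: subset_trans GH.
by move=> y /=; rewrite inE => /orP[/eqP->//|/sG/GH].
Qed.

Lemma exists_regular_subtree : exists F, finite_regular_subtree F.
Proof.
have [x] := vertex0 T; have /eq_cardSP[y /= xy _] := adj_regular x.
have sg a b : adj a b -> [set z | [set a; b] z /\ adj a z] = [set b].
  move=> ab; apply/seteqP; split=> z /= => [[[->|->]//]|->]; first by rewrite adj_irr.
  by split=> //; right.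
exists [set x; y]; split.
- by rewrite finite_setU; split; exact: finite_set1.
- by exists x; left.
- apply: (@con_hub _ x); first by left.
  move=> z [->|->]; first by exists [::].
  exists [:: x]; split=> //=; first by rewrite andbT adj_sym.
  by move=> t; rewrite inE => /eqP ->; left.
- move=> z /= Fz; left; split=> //; apply/card_eq1P.
  case: Fz => ->; first by exists y; exact: sg.
  by exists x; rewrite setUC; apply: sg; exact: adj_sym'.
Qed.

Lemma ray_leaves F (r : ray) : finite_set F ->
  exists N, forall n, N <= n -> ~ F (r n).
Proof.
move=> fF.
have : finite_set (r @^-1` F) by apply: finite_preimage => // ? ? _ _; exact: ray_inj.
move=> /finite_seqP[s e]; exists (\max_(i <- s) i).+1 => n Nn Frn.
have : (r @^-1` F) n by [].
rewrite e /= => ns; have : n <= \max_(i <- s) i by exact: (leq_bigmax_seq n ns isT).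
by rewrite leqNgt Nn.
Qed.

Lemma end_forest_ray F (e : ends) : finite_set F ->
  exists2 r, forest_ray F r & e = end_of r.
Proof.
move=> fF; have [r ->] := endP e; have [N h] := ray_leaves r fF.
have ri : injective (fun n => r (N + n)).
  by move=> a b /ray_inj/eqP; rewrite eqn_add2l => /eqP.
have ra n : adj (r (N + n)) (r (N + n.+1)) by rewrite addnS; exact: ray_adj.
exists (Ray ri ra).
  move=> n /=; split; first by apply/forestN/h; rewrite leq_addr.
  by split=> // -[] /h; rewrite leq_addr => /(_ isT).
by apply/end_of_eq; exists N, 0.
Qed.

Lemma iso_inv F1 F2 phi : forest_iso F1 F2 phi -> exists psi,
  [/\ forest_iso F2 F1 psi, forall x, forest F1 x -> psi (phi x) = x &
      forall y, forest F2 y -> phi (psi y) = y].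
Proof.
move=> [[ff inj sur] ad lf].
have : forall y, exists x, forest F2 y -> forest F1 x /\ phi x = y.
  move=> y; have [fy|nfy] := pselect (forest F2 y); last by exists y.
  by have [x fx xy] := sur _ fy; exists x.
move=> /choice[psi hpsi].
have p1 y : forest F2 y -> forest F1 (psi y) by move=> /hpsi[].
have p2 y : forest F2 y -> phi (psi y) = y by move=> /hpsi[].
have p3 x : forest F1 x -> psi (phi x) = x.
  move=> fx; have fp := ff _ fx; apply: inj; rewrite ?inE//; first exact: p1.
  exact: p2.
exists psi; split=> //; split.
- split=> //.
  + move=> x y; rewrite !inE => fx fy e; by rewrite -(p2 _ fx) -(p2 _ fy) e.
  + by move=> x fx; exists (phi x); [exact: ff|exact: p3].
- by move=> x y fx fy; rewrite -ad ?p2//; exact: p1.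
- by move=> x fx; rewrite -lf ?p2//; exact: p1.
Qed.

Lemma iso_ray F1 F2 phi (r : ray) : forest_iso F1 F2 phi -> forest_ray F1 r ->
  exists2 s : ray, (forall n, s n = phi (r n)) & forest_ray F2 s.
Proof.
move=> [[ff inj sur] ad lf] fr.
have ri : injective (fun n => phi (r n)).
  move=> a b /inj; rewrite !inE => e; apply: (@ray_inj r); apply: e.
    by have [] := fr a.
  by have [] := fr b.
have fa n : forest_adj F2 (phi (r n)) (phi (r n.+1)).
  have [f1 a1] := fr n; have [f2 _] := fr n.+1; exact/ad.
exists (Ray ri (fun n => (fa n).1)) => // n; split; last exact: fa.
by apply: ff; have [] := fr n.
Qed.

Lemma ray_ext (r s : ray) : (forall n, r n = s n) -> end_of r = end_of s.
Proof. by move=> e; apply/end_of_eq; exists 0, 0 => k; rewrite e. Qed.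

Lemma induced_inv F1 F2 f : finite_regular_subtree F1 -> finite_regular_subtree F2 ->
  induced_by_iso F1 F2 f ->
  exists g, [/\ cancel f g, cancel g f & induced_by_iso F2 F1 g].
Proof.
move=> rF1 rF2 [phi [iphi fphi]]; have [psi [ipsi K1 K2]] := iso_inv iphi.
have back s : forest_ray F2 s -> exists2 r : ray, (forall n, r n = psi (s n)) &
    f (end_of r) = end_of s.
  move=> fs; have [r rE fr] := iso_ray ipsi fs; exists r => //.
  have [s' s'E ->] := fphi _ fr; apply: ray_ext => n.
  by rewrite s'E rE K2//; have [] := fs n.
have sur e : exists d, f d = e.
  have [fF2 _ _ _] := rF2; have [s fs ->] := end_forest_ray e fF2.
  by have [r _ h] := back _ fs; exists (end_of r).
have inj : injective f.
  move=> d e; have [fF1 _ _ _] := rF1.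
  have [r fr ->] := end_forest_ray d fF1; have [r' fr' ->] := end_forest_ray e fF1.
  have [s sE ->] := fphi _ fr; have [s' s'E ->] := fphi _ fr'.
  move=> /end_of_eq[m [n h]]; apply/end_of_eq; exists m, n => k.
  have [f1 _] := fr (m + k); have [f2 _] := fr' (n + k).
  by rewrite -(K1 _ f1) -(K1 _ f2) -sE -s'E h.
have [g gK] := choice sur.
exists g; split=> //; first by move=> d; apply: inj; rewrite gK.
exists psi; split=> // s fs; have [r rE e] := back _ fs.
by exists r => //; apply: inj; rewrite gK e.
Qed.

Lemma internal_mono F A x : F `<=` A -> internal F x -> internal A x.
Proof.
by move=> FA ix; apply: internalI => [|y /(internal_nbr ix)]; apply: FA => //; case: ix.
Qed.

Section Pullback.
Variables (F1 F2 B : set T) (phi : T -> T).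
Hypotheses (rF1 : finite_regular_subtree F1) (rF2 : finite_regular_subtree F2).
Hypotheses (rB : finite_regular_subtree B) (F2B : F2 `<=` B).
Hypothesis iphi : forest_iso F1 F2 phi.

Let G : set T := [set x | internal F1 x \/ forest F1 x /\ B (phi x)].

Let fphi x : forest F1 x -> forest F2 (phi x).
Proof. by case: iphi => -[h _ _] _ _; exact: h. Qed.

Let inj x y : forest F1 x -> forest F1 y -> phi x = phi y -> x = y.
Proof. by case: iphi => -[_ h _] _ _ fx fy; apply: h; rewrite inE. Qed.

Let sur y : forest F2 y -> exists2 x, forest F1 x & phi x = y.
Proof. by case: iphi => -[_ _ h] _ _ /h[x]; exists x. Qed.

Let phiF x : forest F1 x -> (F2 (phi x) <-> F1 x).
Proof.
case: iphi => _ _ lf fx; split.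
  by move=> /(forest_leaf rF2 (fphi fx)) /lf => /(_ fx)[].
by move=> /(forest_leaf rF1 fx)/(lf _ fx)[].
Qed.

Let ad x y : forest F1 x -> forest F1 y -> ~ F1 x \/ ~ F1 y ->
  (adj (phi x) (phi y) <-> adj x y).
Proof.
move=> fx fy n; case: iphi => _ h _.
have n1 : ~ (F1 x /\ F1 y) by case: n => n [].
have n2 : ~ (F2 (phi x) /\ F2 (phi y)).
  by rewrite phiF// phiF.
split=> a; first by have [/(_ (conj a n2))[]] := h x y fx fy.
by have [_ /(_ (conj a n1))[]] := h x y fx fy.
Qed.

Let GE x : forest F1 x -> (G x <-> B (phi x)).
Proof. by move=> fx; split=> [[//|[]//]|]; right. Qed.

Let F1G : F1 `<=` G.
Proof.
move=> x Fx; have [|fx] := pselect (internal F1 x); first by left.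
by right; split=> //; apply/F2B/phiF.
Qed.

Let nbr_card x : forest F1 x -> G x ->
  [set y | G y /\ adj x y] #= [set z | B z /\ adj (phi x) z].
Proof.
move=> fx Gx; have [Fx|nFx] := pselect (F1 x).
  have [_ /card_eq1P[y0 e1]] := forest_leaf rF1 fx Fx.
  have [_ /card_eq1P[z0 e2]] := forest_leaf rF2 (fphi fx) ((phiF fx).2 Fx).
  have [Fy0 xy0] : F1 y0 /\ adj x y0 by have : [set y0] y0 by []; rewrite -e1.
  have [Fz0 xz0] : F2 z0 /\ adj (phi x) z0 by have : [set z0] z0 by []; rewrite -e2.
  have uy y : F1 y -> adj x y -> y = y0.
    by move=> Fy xy; suff : [set y0] y by []; rewrite -e1.
  have uz z : F2 z -> adj (phi x) z -> z = z0.
    by move=> Fz xz; suff : [set z0] z by []; rewrite -e2.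
  have nF y : ~ F1 y -> ~ F2 (phi y) by move=> /[dup] /forestN /phiF ->.
  apply: (@bij_card _ _ (fun y => if `[< F1 y >] then z0 else phi y)); split.
  - move=> y /= [Gy xy]; case: asboolP => [Fy|nFy].
      by split=> //; exact: F2B.
    have fy := forestN nFy; split; first exact/GE.
    by apply/ad => //; right.
  - move=> y y'; rewrite !inE /= => -[Gy xy] [Gy' xy'].
    case: asboolP => [Fy|nFy]; case: asboolP => [Fy'|nFy'] e.
    + by rewrite (uy _ Fy xy) (uy _ Fy' xy').
    + by case: (nF _ nFy'); rewrite -e.
    + by case: (nF _ nFy); rewrite e.
    + by apply: inj e; exact: forestN.
  - move=> z /= [Bz xz]; have [Fz|nFz] := pselect (F2 z).
      exists y0; first by split=> //; exact: F1G.
      by rewrite asboolT// (uz z).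
    have [y fy yz] := sur (forestN nFz); subst z.
    have nFy : ~ F1 y by move=> /(phiF fy).
    exists y; last by rewrite asboolF.
    by split; [exact/GE|apply/ad => //; right].
apply: (@bij_card _ _ phi).
have fn y : adj x y -> forest F1 y.
  by move=> xy iy; apply: nFx; apply: internal_nbr iy (adj_sym' xy).
split.
- move=> y /= [Gy xy]; have fy := fn _ xy; split; first exact/GE.
  by apply/ad => //; left.
- by move=> y y'; rewrite !inE /= => -[_ /fn fy] [_ /fn fy']; exact: inj.
- move=> z /= [Bz xz].
  have fz : forest F2 z.
    move=> iz; apply: nFx; apply/(phiF fx); apply: internal_nbr iz (adj_sym' xz).
  have [y fy yz] := sur fz; subst z.
  by exists y => //; split; [exact/GE|apply/ad => //; left].
Qed.

Let degE x n : forest F1 x -> G x -> (has_degree G x n <-> has_degree B (phi x) n).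
Proof.
move=> fx Gx; rewrite /has_degree; have c := nbr_card fx Gx.
by split=> h; [rewrite -(card_eql c)|rewrite (card_eql c)].
Qed.

Let leafE x : forest F1 x -> (leaf B (phi x) <-> leaf G x).
Proof.
by move=> fx; split=> -[Bx] d; [have Gx := (GE fx).2 Bx|have Gx := (GE fx).1 Bx];
  split=> //; apply/degE.
Qed.

Let internalE x : forest F1 x -> (internal B (phi x) <-> internal G x).
Proof.
by move=> fx; split=> -[Bx] d; [have Gx := (GE fx).2 Bx|have Gx := (GE fx).1 Bx];
  split=> //; apply/degE.
Qed.

Let forestG x : forest G x <-> forest F1 x /\ forest B (phi x).
Proof.
split=> [fx|[fx fpx] /(internalE fx)//].
have fx1 : forest F1 x by move=> /(internal_mono F1G).
by split=> // /(internalE fx1).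
Qed.

Let rG : finite_regular_subtree G.
Proof.
have [fF1 [o Fo] cF1 dF1] := rF1; have [fB _ cB dB] := rB.
have Go := F1G Fo; split.
- have [psi [_ K1 _]] := iso_inv iphi.
  apply: (@sub_finite_set _ _ (F1 `|` psi @` B)).
    move=> x [[Fx _]|[fx Bx]]; first by left.
    by right; exists (phi x) => //; exact: K1.
  by rewrite finite_setU; split=> //; exact: finite_image.
- by exists o.
- apply: (con_hub Go) => x Gx.
  have base y : F1 y -> exists p, [/\ path adj y p, last y p = o & {in p, forall z, G z}].
    move=> Fy; have [p [? ? pF]] := cF1 _ _ Fy Fo.
    by exists p; split=> // z /pF/F1G.
  case: Gx => [[/base//]|[fx Bx]].
  have [_ [w F2w] _ _] := rF2; have [p [xp lp pB]] := cB _ _ Bx (F2B F2w).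
  elim: p x fx Bx xp lp pB => [|v p IH] x fx Bx /=.
    by move=> _ e _; apply: base; apply/(phiF fx); rewrite e.
  move=> /andP[xv vp] lp pB.
  have [/(phiF fx)/base//|nFx] := pselect (F2 (phi x)).
  have fv : forest F2 v by move=> iv; apply: nFx; exact: internal_nbr iv (adj_sym' xv).
  have [y fy yv] := sur fv; subst v.
  have By : B (phi y) by apply: pB; rewrite mem_head.
  have xy : adj x y by apply/ad => //; left => /(phiF fx).
  have [|s [ys ls sG]] := IH y fy By vp lp.
    by move=> z zp; apply: pB; rewrite inE zp orbT.
  exists (y :: s); split=> //=; first by rewrite xy.
  by move=> z; rewrite inE => /orP[/eqP->|/sG//]; exact/GE.
- move=> x Gx; have [ix|fx] := pselect (internal F1 x).
    by right; exact: internal_mono ix.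
  by case: (dB _ ((GE fx).1 Gx)) => [/leafE|/internalE]; [left|right]; auto.
Qed.

Let isoG : forest_iso G B phi.
Proof.
split.
- split.
  + by move=> x /forestG[].
  + by move=> x y; rewrite !inE => /forestG[fx _] /forestG[fy _]; exact: inj.
  + move=> y fy; have f2 : forest F2 y by move=> /(internal_mono F2B).
    by have [x fx xy] := sur f2; exists x => //; apply/forestG; rewrite xy.
- move=> x y /forestG[fx _] /forestG[fy _]; rewrite /forest_adj GE// GE//.
  have [Fxy|nF] := pselect (F1 x /\ F1 y).
    have : B (phi x) /\ B (phi y) by case: Fxy => /F1G/(GE fx) ? /F1G/(GE fy).
    by tauto.
  have : ~ F1 x \/ ~ F1 y by apply/not_andP.
  by move=> /(ad fx fy) ->.
- by move=> x /forestG[fx _]; exact: leafE.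
Qed.

Lemma pullback f : induces F1 phi f -> exists G,
  [/\ finite_regular_subtree G, F1 `<=` G & induced_by_iso G B f].
Proof.
move=> h; exists G; split=> //; exists phi; split=> // r fr; apply: h => n.
have [/forestG[f1 _] [a nG]] := fr n; split=> //; split=> // -[/F1G ? /F1G ?].
exact: nG.
Qed.

End Pullback.

Lemma sphero_id : spheromorphism id.
Proof.
have [F rF] := exists_regular_subtree; exists F, F; split=> //.
exists id; split; last by move=> r _; exists r.
split=> //; split=> // x; by exists x.
Qed.

Lemma sphero_inv f : spheromorphism f ->
  exists g, [/\ spheromorphism g, cancel f g & cancel g f].
Proof.
move=> [F1 [F2 [r1 r2 h]]]; have [g [K1 K2 hg]] := induced_inv r1 r2 h.
by exists g; split=> //; exists F2, F1.
Qed.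

Lemma induced_comp F1 F2 F3 f g : induced_by_iso F1 F2 f ->
  induced_by_iso F2 F3 g -> induced_by_iso F1 F3 (g \o f).
Proof.
move=> [phi [iphi hf]] [psi [ipsi hg]]; exists (psi \o phi).
case: (iphi) (ipsi) => -[ff inj sur] ad lf [[ff' inj' sur'] ad' lf'].
split; first split.
- split.
  + by move=> x /ff/ff'.
  + move=> x y; rewrite !inE => fx fy /inj' e; apply: inj; rewrite ?inE//.
    by apply: e; rewrite inE; exact: ff.
  + by move=> z /sur'[y /sur[x fx <-] <-]; exists x.
- by move=> x y fx fy; rewrite /= ad' ?ad//; exact: ff.
- by move=> x fx; rewrite /= lf' ?lf//; exact: ff.
move=> r fr; have [s sE fs] := iso_ray iphi fr.
have [s' s'E e] := hf _ fr; have [t tE et] := hg _ fs.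
exists t; first by move=> n; rewrite tE sE.
by rewrite /= e -et; congr g; apply: ray_ext => n; rewrite s'E sE.
Qed.

Lemma sphero_comp f g : spheromorphism f -> spheromorphism g ->
  spheromorphism (f \o g).
Proof.
move=> [F3 [F4 [r3 r4 hf]]] [F1 [F2 [r1 r2 [phi [iphi hg]]]]].
have [B [rB F2B F3B]] : exists B, [/\ finite_regular_subtree B, F2 `<=` B & F3 `<=` B].
  by apply: absorb_fin => //; case: r3.
have [G1 [rG1 _ h1]] := pullback r1 r2 rB F2B iphi hg.
have [f' [K1 K2 [psi [ipsi hf']]]] := induced_inv r3 r4 hf.
have [G2 [rG2 _ h2]] := pullback r4 r3 rB F3B ipsi hf'.
have [f2 [K3 K4 hf2]] := induced_inv rG2 rB h2.
have -> : f = f2 by apply/funext => e; rewrite -[RHS]K2 K4.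
by exists G1, G2; split=> //; exact: induced_comp h1 hf2.
Qed.

Record neretin := Neretin {
  neretin_fun :> ends -> ends;
  neretinP : spheromorphism neretin_fun }.

HB.instance Definition _ := gen_eqMixin neretin.
HB.instance Definition _ := gen_choiceMixin neretin.

Lemma neretin_ext (f g : neretin) : neretin_fun f = neretin_fun g -> f = g.
Proof.
case: f g => [f hf] [g hg] /= e; subst g; congr Neretin; exact: Prop_irrelevance.
Qed.

Definition neretin_one : neretin := Neretin sphero_id.

Definition neretin_mul (f g : neretin) : neretin :=
  Neretin (sphero_comp (neretinP f) (neretinP g)).

Lemma neretin_inv_subproof (f : neretin) :
  exists g : neretin, cancel f g /\ cancel g f.
Proof.
by have [g [hg ? ?]] := sphero_inv (neretinP f); exists (Neretin hg).
Qed.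

Definition neretin_inv (f : neretin) : neretin :=
  projT1 (cid (neretin_inv_subproof f)).

Lemma neretin_mulA : associative neretin_mul.
Proof. by move=> f g h; exact: neretin_ext. Qed.

Lemma neretin_mul1 : left_id neretin_one neretin_mul.
Proof. by move=> f; exact: neretin_ext. Qed.

Lemma neretin_1mul : right_id neretin_one neretin_mul.
Proof. by move=> f; exact: neretin_ext. Qed.

Lemma neretin_mulV : left_inverse neretin_one neretin_inv neretin_mul.
Proof.
move=> f; apply: neretin_ext; apply/funext => e /=; rewrite /neretin_inv.
by case: cid => g /= [K _]; rewrite K.
Qed.

Lemma neretin_Vmul : right_inverse neretin_one neretin_inv neretin_mul.
Proof.
move=> f; apply: neretin_ext; apply/funext => e /=; rewrite /neretin_inv.
by case: cid => g /= [_ K]; rewrite K.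
Qed.

HB.instance Definition _ := isGroup.Build neretin neretin_mulA neretin_mul1
  neretin_1mul neretin_mulV neretin_Vmul.

End Neretin.

(* Main.v *)
From mathcomp Require Import all_boot fingroup perm finmap.
From mathcomp Require Import boolp classical_sets functions cardinality.
Require Import Defs.

(** Once a base edge is chosen and the children of every vertex are labelled,
the vertices of [T] are the pairs of an end of that edge and a finite word in
[q] letters, and the boundary consists of the pairs with an infinite word. The
half-trees pointing away from the base edge become the cylinders
[{(b, w s) : s}]. An element of the Neretin group cuts the boundary into
finitely many cylinders and carries each of them to a cylinder by an
automorphism of the rooted [q]-ary tree ([neretin_sims]). Two kinds of elements
suffice for the proof: the automorphisms of one cylinder, extended by the
identity ([local_aut_exists]), and the swaps of two disjoint cylinders that keep
the remaining letters ([swap_exists]).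

Let [K] be a normal subgroup containing some [k <> 1]. Some cylinder [C] is
disjoint from its image under [k] ([displace]), and then [K] contains the
commutator of any two elements supported in [C] ([displaced_commutator]). An
automorphism of a small cylinder inside [C] is such a commutator, by repeating
it along a sequence of cylinders that converge to a point and are shifted by an
element supported in [C] ([local_aut_commutator]). All cylinders are conjugate
([transport]), so [K] contains all automorphisms of cylinders
([normal_local_aut]). The swap of two sibling cylinders is one of them, and
every swap of two cylinders that leave a third one free is conjugate to such a
swap ([normal_swap]).

It remains to see that these elements generate the group ([generated]). Let [f]
be a similarity on each piece of a partition [U] into cylinders, with target
partition [V]. A longest word of [U] has all its siblings in [U], and likewise
for [V]. Composing [f] with swaps and automorphisms of the pieces of [U]
([arrange]), it sends a family of siblings to a family of siblings with labels
kept; so it is a similarity on the parent cylinder and [U] can be replaced with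
a smaller partition. When only the two halves of the boundary are left, each is
cut into the cylinders of its children, and one more arrangement makes [f]
trivial. *)

Set Implicit Arguments.
Unset Strict Implicit.
Unset Printing Implicit Defensive.

(** * Words and cylinders *)

Section Words.
Variable q : nat.

(** A vertex is named by the end of a fixed base edge from which it is reached
without crossing that edge, and by the labels read along the way; a point of
the boundary is an infinite such name. *)
Definition word : Type := (bool * seq 'I_q)%type.

Definition point : Type := (bool * (nat -> 'I_q))%type.

Implicit Types (u v w : word) (t : seq 'I_q) (s : nat -> 'I_q) (xi : point).

Definition wcat u t : word := (u.1, u.2 ++ t).
Definition child u i : word := (u.1, rcons u.2 i).
(** The neighbour of [u] towards the base edge: across the edge when [u] is one
of its two ends. *)
Definition up u : word :=
  if u.2 is i :: t then (u.1, belast i t) else (~~ u.1, [::]).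
Definition wroot b : word := (b, [::]).

Lemma wcat0 u : wcat u [::] = u.
Proof. by case: u => b t; rewrite /wcat cats0. Qed.

Lemma wcatA u t t' : wcat (wcat u t) t' = wcat u (t ++ t').
Proof. by rewrite /wcat /= catA. Qed.

Lemma wcat_rcons u t i : wcat u (rcons t i) = child (wcat u t) i.
Proof. by rewrite /child /= rcons_cat. Qed.

Lemma child_cat u i : child u i = wcat u [:: i].
Proof. by rewrite /child -cats1. Qed.

Lemma up_child u i : up (child u i) = u.
Proof.
by case: u => b [|j t] //; rewrite /up /child /= belast_rcons.
Qed.

Lemma child_inj u v i j : child u i = child v j -> u = v /\ i = j.
Proof.
case: u v => b t [b' t'] [-> /rcons_inj[-> ->]]; by [].
Qed.

Lemma wordP u : (exists b, u = wroot b) \/ (exists v i, u = child v i).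
Proof.
case: u => b t; case: (lastP t) => [|t' i]; first by left; exists b.
by right; exists (b, t'), i.
Qed.

Lemma word_ind (P : word -> Prop) :
  (forall b, P (wroot b)) -> (forall u i, P u -> P (child u i)) ->
  forall u, P u.
Proof.
move=> P0 P1 [b t]; elim/last_ind: t => [|t i IH]; first exact: P0.
exact: (P1 (b, t)).
Qed.

Definition wpre u w := (u.1 == w.1) && prefix u.2 w.2.

Lemma wpreP u w : reflect (exists t, w = wcat u t) (wpre u w).
Proof.
apply: (iffP andP) => [[/eqP e /prefixP[t et]]|[t ->]].
  by exists t; case: w e et => b w /= <- ->.
by rewrite /= eqxx prefix_prefix.
Qed.

Lemma wpre_cat u t : wpre u (wcat u t).
Proof. by apply/wpreP; exists t. Qed.

Lemma wpre_refl u : wpre u u.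
Proof. by rewrite -{2}[u]wcat0 wpre_cat. Qed.

Lemma wpre_trans u v w : wpre u v -> wpre v w -> wpre u w.
Proof. by move=> /wpreP[t ->] /wpreP[t' ->]; rewrite wcatA wpre_cat. Qed.

Lemma wpre_comp u v w : wpre u w -> wpre v w -> wpre u v \/ wpre v u.
Proof.
move=> /wpreP[t ->] /wpreP[t' []]; case: u v => b u [b' v] /= <- e.
have [h|h] := leqP (size u) (size v); [left|right]; apply/wpreP.
  exists (drop (size u) v); rewrite /wcat /=; congr pair.
  have eu : u = take (size u) v.
    by rewrite -(takel_cat t' h) -e take_size_cat.
  by rewrite {1}eu cat_take_drop.
exists (drop (size v) u); rewrite /wcat /=; congr pair.
have ev : v = take (size v) u.
  by rewrite -(takel_cat t (ltnW h)) e take_size_cat.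
by rewrite {1}ev cat_take_drop.
Qed.

Lemma wpre_size u v : wpre u v -> size u.2 <= size v.2.
Proof. by case/andP=> _ /size_prefix. Qed.

Lemma wpre_anti u v : wpre u v -> size v.2 <= size u.2 -> u = v.
Proof.
move=> /wpreP[t ->] /=; rewrite size_cat -{2}[size u.2]addn0 leq_add2l leqn0.
by move=> /nilP ->; rewrite wcat0.
Qed.

Lemma wpre_child u v i : wpre u (child v i) -> u = child v i \/ wpre u v.
Proof.
move=> /wpreP[t]; case: (lastP t) => [|t' j]; first by rewrite wcat0 => ->;
  left.
by rewrite wcat_rcons => /child_inj[-> _]; right; exact: wpre_cat.
Qed.

Lemma wcat_inj u t t' : wcat u t = wcat u t' -> t = t'.
Proof. by move=> [] /eqP; rewrite eqseq_cat// eqxx => /eqP. Qed.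

Definition incomp u v := ~~ wpre u v && ~~ wpre v u.

Lemma incompC u v : incomp u v = incomp v u.
Proof. by rewrite /incomp andbC. Qed.

Lemma incomp_wcat u v t t' : incomp u v -> wcat u t <> wcat v t'.
Proof.
move=> /andP[/negP n1 /negP n2] e.
by case: (@wpre_comp u v (wcat u t)); rewrite ?wpre_cat// e wpre_cat.
Qed.

Lemma incomp_cat u v t t' : incomp u v -> incomp (wcat u t) (wcat v t').
Proof.
move=> h; apply/andP; split; apply/negP => /wpreP[r]; rewrite wcatA.
  by apply/nesym; exact: incomp_wcat.
exact: incomp_wcat.
Qed.

Lemma incomp_child u i j : i != j -> incomp (child u i) (child u j).
Proof.
move=> ij; rewrite /incomp; apply/andP; split; apply/negP => /wpre_anti;
  rewrite !size_rcons => /(_ (leqnn _)) /child_inj[_ e];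
    by rewrite e eqxx in ij.
Qed.

Lemma incomp_side u v : u.1 != v.1 -> incomp u v.
Proof.
by rewrite /incomp /wpre => /[dup]; rewrite {2}eq_sym => /negPf-> /negPf->.
Qed.

Fixpoint scat t s : nat -> 'I_q :=
  if t is i :: t' then fun n => if n is m.+1 then scat t' s m else i else s.

Definition cyl u s : point := (u.1, scat u.2 s).

Lemma scat_cat t t' s : scat (t ++ t') s = scat t (scat t' s).
Proof. by elim: t => //= i t ->. Qed.

Lemma cyl_cat u t s : cyl (wcat u t) s = cyl u (scat t s).
Proof. by rewrite /cyl /= scat_cat. Qed.

Lemma scat_inj t s s' : scat t s = scat t s' -> s = s'.
Proof.
elim: t => //= i t IH e; apply: IH; apply/funext => n.
by move: (congr1 (fun f => f n.+1) e).
Qed.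

Lemma cyl_inj u s s' : cyl u s = cyl u s' -> s = s'.
Proof. by move=> [] /scat_inj. Qed.

Lemma mkseq_scat t s n : mkseq (scat t s) (size t + n) = t ++ mkseq s n.
Proof.
elim: t => // i t IH; rewrite /= addSn /mkseq /= -IH; congr (_ :: _).
by rewrite /mkseq (iotaDl 1) -map_comp.
Qed.

Lemma scat_mkseq s n : scat (mkseq s n) (fun m => s (n + m)) = s.
Proof.
elim: n s => [|n IH] s; first by apply/funext.
apply/funext => -[|m] //=.
have -> : [seq s i | i <- iota 1 n] = mkseq (fun m => s m.+1) n.
  by rewrite /mkseq (iotaDl 1) -map_comp.
by rewrite -[RHS](congr1 (fun f => f m) (IH (fun m => s m.+1))).
Qed.

Lemma mkseq_inj_all s s' : (forall n, mkseq s n = mkseq s' n) -> s = s'.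
Proof.
move=> h; apply/funext => n.
move: (congr1 (fun t => nth (s 0) t n) (h n.+1)).
by rewrite !nth_mkseq.
Qed.

Definition in_cyl u xi := exists s, xi = cyl u s.

Lemma in_cyl_cyl u s : in_cyl u (cyl u s).
Proof. by exists s. Qed.

Lemma in_cyl_wpre u v xi : wpre u v -> in_cyl v xi -> in_cyl u xi.
Proof. by move=> /wpreP[t ->] [s ->]; rewrite cyl_cat; exists (scat t s). Qed.

Definition trunc xi n : word := (xi.1, mkseq xi.2 n).

Lemma in_cyl_trunc xi n : in_cyl (trunc xi n) xi.
Proof.
by exists (fun m => xi.2 (n + m)); case: xi => b s; rewrite /cyl /= scat_mkseq.
Qed.

Lemma in_cylE u xi : in_cyl u xi <-> u = trunc xi (size u.2).
Proof.
split=> [[s ->]|->]; last exact: in_cyl_trunc.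
by case: u => b t; rewrite /trunc /= -[size t in RHS]addn0 mkseq_scat cats0.
Qed.

Lemma in_cyl_comp u v xi : in_cyl u xi -> in_cyl v xi -> wpre u v \/ wpre v u.
Proof.
move=> /in_cylE eu /in_cylE ev.
have [h|h] := leqP (size u.2) (size v.2); [left|right].
  rewrite eu ev; apply/wpreP; exists (drop (size u.2) v.2).
  rewrite /wcat /trunc /= ; congr pair.
  have -> : mkseq xi.2 (size u.2) = take (size u.2) v.2.
    by rewrite [in RHS]ev /= /mkseq -map_take take_iota (minn_idPl h).
  by rewrite cat_take_drop {2}ev.
rewrite eu ev; apply/wpreP; exists (drop (size v.2) u.2).
rewrite /wcat /trunc /= ; congr pair.
have -> : mkseq xi.2 (size v.2) = take (size v.2) u.2.
  by rewrite [in RHS]eu /= /mkseq -map_take take_iota (minn_idPl (ltnW h)).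
by rewrite cat_take_drop {2}eu.
Qed.

Lemma in_cyl_incomp u v xi : incomp u v -> in_cyl u xi -> ~ in_cyl v xi.
Proof. by move=> /andP[/negP n1 /negP n2] h1 h2; case: (in_cyl_comp h1 h2). Qed.

Lemma incomp_cyl u v s s' : incomp u v -> cyl u s <> cyl v s'.
Proof.
by move=> /in_cyl_incomp h e; apply: (h (cyl u s) (in_cyl_cyl _ _)); exists s'.
Qed.

Lemma cyl_scons u s : cyl u s = cyl (child u (s 0)) (fun n => s n.+1).
Proof.
rewrite child_cat cyl_cat; congr cyl; apply/funext => -[|n] //.
Qed.

Definition wrest u w := drop (size u.2) w.2.

Lemma wrest_cat u t : wrest u (wcat u t) = t.
Proof. by rewrite /wrest /= drop_size_cat. Qed.

Definition spre u w := wpre w u && (w != u).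

Lemma spre_size u w : spre u w -> size w.2 < size u.2.
Proof.
case/andP=> p; apply: contraNltn => h; apply/eqP; exact: wpre_anti.
Qed.

Lemma spre_child u w i : spre u (child w i) -> spre u w.
Proof.
have p : wpre w (child w i) by rewrite child_cat wpre_cat.
move=> h; have := spre_size h; case/andP: (h) => h1 _; rewrite size_rcons => sz.
apply/andP; split; first exact: wpre_trans h1.
by apply: contraTN sz => /eqP ->; rewrite -leqNgt leqnSn.
Qed.

Lemma not_spre u w : wpre u w -> ~~ spre u w.
Proof.
by move=> p; apply/negP => /andP[p' /eqP]; apply; apply: wpre_anti p' _;
  exact: wpre_size.
Qed.

Lemma spre_up u : u.2 != [::] -> spre u (up u).
Proof.
case: (wordP u) => [[b ->]|[v [i ->]]] // _;
  rewrite up_child /spre child_cat wpre_cat.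
by apply/negP => /eqP /(congr1 (fun w => size w.2));
  rewrite /= size_cat addn1 => /eqP;
  rewrite -[X in X == _]addn0 -addn1 eqn_add2l.
Qed.

Lemma scat_cons s : s = scat [:: s 0] (fun n => s n.+1).
Proof. by apply/funext => -[]. Qed.

Lemma truncS xi n : trunc xi n.+1 = child (trunc xi n) (xi.2 n).
Proof. by rewrite /trunc mkseqS. Qed.

Lemma trunc_cyl u s n : trunc (cyl u s) (size u.2 + n) = wcat u (mkseq s n).
Proof. by rewrite /trunc mkseq_scat. Qed.

Lemma trunc_inj xi xi' : (forall n, trunc xi n = trunc xi' n) -> xi = xi'.
Proof.
case: xi xi' => b s [b' s'] e; have eb : b = b' := congr1 fst (e 0).
rewrite eb; congr (_, _); apply: mkseq_inj_all => n; exact: (congr1 snd (e n)).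
Qed.

(** Finite partitions of the boundary into cylinders. *)
Definition complete_code (U : seq word) : Prop := [/\ uniq U,
  forall xi, exists2 u, u \in U & in_cyl u xi &
  forall xi u v, u \in U -> v \in U -> in_cyl u xi -> in_cyl v xi -> u = v].

Lemma incomp_wcatl u t t' :
  incomp (wcat u t) (wcat u t') = ~~ prefix t t' && ~~ prefix t' t.
Proof.
have h (x y : seq 'I_q) : wpre (wcat u x) (wcat u y) = prefix x y.
  rewrite /wpre /= eqxx /=; apply/prefixP/prefixP => -[s e]; exists s.
    by move: e; rewrite -catA => /eqP; rewrite eqseq_cat// eqxx => /eqP.
  by rewrite e catA.
by rewrite /incomp !h.
Qed.

Lemma in_cyl_trunc_eq w x y m : in_cyl w x -> in_cyl w y ->
  m <= size w.2 -> trunc x m = trunc y m.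
Proof.
move=> /in_cylE ex /in_cylE ey mw;
  have e : trunc x (size w.2) = trunc y (size w.2) by rewrite -ex.
have := congr1 (take m \o snd) e;
  rewrite /= /mkseq -!map_take take_iota (minn_idPl mw).
by move=> h; rewrite /trunc [x.1](congr1 fst e) /mkseq h.
Qed.

(** Fails for one letter, where all cylinders on one side coincide. *)
Lemma cyl_subset u v : 1 < q -> (forall s, in_cyl u (cyl v s)) -> wpre u v.
Proof.
move=> q2 h; pose s0 (i : 'I_q) : nat -> 'I_q := fun=> i.
pose o0 : 'I_q := Ordinal (ltnW q2); pose o1 : 'I_q := Ordinal q2.
case: (in_cyl_comp (h (s0 o0)) (in_cyl_cyl _ _)) => // /wpreP[[|i t] e].
  by rewrite e wcat0 wpre_refl.
have [j ij] : exists j, j != i.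
  by have [->|] := eqVneq i o0; [exists o1|exists o0; rewrite eq_sym].
have [s] := h (s0 j); rewrite e cyl_cat => /cyl_inj /(congr1 (fun f => f 0))
  /= /eqP.
by rewrite (negPf ij).
Qed.

Lemma complete_incomp (U : seq word) u v (i : 'I_q) :
  complete_code U -> u \in U -> v \in U -> u != v -> incomp u v.
Proof.
move=> [_ _ h] uU vU uv; pose s : nat -> 'I_q := fun=> i.
apply/andP; split; apply/negP => p; move/eqP: uv; apply.
  by apply: (h (cyl v s)) => //; [apply: in_cyl_wpre p _|]; exact: in_cyl_cyl.
by apply: (h (cyl u s)) => //; [|apply: in_cyl_wpre p _]; exact: in_cyl_cyl.
Qed.

Lemma incomp_notin_cyl u w s : incomp u w -> ~ in_cyl u (cyl w s).
Proof. by rewrite incompC => /in_cyl_incomp; apply; exact: in_cyl_cyl. Qed.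

(** * Portraits of automorphisms of the rooted tree of words *)

(** An automorphism of the rooted [q]-ary tree of words is the same thing as a
free choice of a permutation of the letters at every word, so it needs no
side conditions in this encoding; [pmap] is its action on words and [pseq] its
action on infinite words. *)
Definition portrait := seq 'I_q -> {perm 'I_q}.

Definition sub (a : portrait) (t : seq 'I_q) : portrait :=
  fun t' => a (t ++ t').

Fixpoint pmap (a : portrait) t :=
  if t is i :: t' then a [::] i :: pmap (sub a [:: i]) t' else [::].

Fixpoint pmap_inv (a : portrait) t :=
  if t is i :: t' then
    let j := ((a [::])^-1)%g i in j :: pmap_inv (sub a [:: j]) t' else [::].

Definition pseq (a : portrait) s : nat -> 'I_q := fun n => a (mkseq s n) (s n).

Lemma pmapK a : cancel (pmap a) (pmap_inv a).
Proof. by move=> t; elim: t a => //= i t IH a; rewrite permK IH. Qed.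

Lemma pmap_invK a : cancel (pmap_inv a) (pmap a).
Proof. by move=> t; elim: t a => //= i t IH a; rewrite permKV IH. Qed.

Lemma pmap_rcons a t i : pmap a (rcons t i) = rcons (pmap a t) (a t i).
Proof. by elim: t a => //= j t IH a; rewrite IH. Qed.

Definition inv_portrait a : portrait := fun t => ((a (pmap_inv a t))^-1)%g.

Lemma pmap_invE a : pmap_inv a =1 pmap (inv_portrait a).
Proof.
move=> t; elim/last_ind: t => // t i; rewrite pmap_rcons => <-.
by rewrite /inv_portrait; elim: t a => [|j t IH] a //=; rewrite IH.
Qed.

Lemma pmap_mkseq a s n : pmap a (mkseq s n) = mkseq (pseq a s) n.
Proof. by elim: n => // n IH; rewrite !mkseqS pmap_rcons IH. Qed.

Definition id_portrait : portrait := fun=> 1%g.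

Lemma pmap_id t : pmap id_portrait t = t.
Proof. by elim/last_ind: t => // t i IH; rewrite pmap_rcons IH perm1. Qed.

Lemma pseq_id s : pseq id_portrait s = s.
Proof. by apply/funext => n; rewrite /pseq perm1. Qed.

(** The self-similarity that lets an automorphism be computed letter by
letter. *)
Lemma pseq_scat a t s : pseq a (scat t s) = scat (pmap a t) (pseq (sub a t) s).
Proof.
elim: t a s => //= i t IH a s.
apply/funext => -[|n]; rewrite /pseq //=.
have -> : mkseq (scat (i :: t) s) n.+1 = i :: mkseq (scat t s) n.
  by rewrite /mkseq /= (iotaDl 1) -map_comp.
by rewrite -[LHS]/(pseq (sub a [:: i]) (scat t s) n) IH.
Qed.

Lemma pseq_invK a : cancel (pseq (inv_portrait a)) (pseq a).
Proof.
move=> s; apply/funext => n.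
by rewrite {1}/pseq -pmap_mkseq -pmap_invE /pseq /inv_portrait permKV.
Qed.

Definition comp_portrait (a b : portrait) : portrait :=
  fun t => (b t * a (pmap b t))%g.

Lemma pseq_comp a b s : pseq a (pseq b s) = pseq (comp_portrait a b) s.
Proof. by apply/funext => n; rewrite /pseq /comp_portrait permM pmap_mkseq. Qed.

Definition one_level (p : {perm 'I_q}) : portrait :=
  fun t => if t is [::] then p else 1%g.

Lemma pseq_one_level p i s :
  pseq (one_level p) (scat [:: i] s) = scat [:: p i] s.
Proof.
by rewrite pseq_scat -[X in scat _ X = _]/(pseq (@id_portrait) s) pseq_id.
Qed.

End Words.

(** * Coordinates on a regular tree *)

Section Reduced.
Variables (q : nat) (T : regular_tree q).
Local Notation adj := (@adj q T).

Fixpoint reduced (p : seq T) : bool :=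
  if p is x :: p' then
    (if p' is y :: z :: _ then x != z else true) && reduced p'
  else true.

(** In an acyclic graph a walk without backtracking never repeats a vertex: the
segment between two closest equal vertices would be a cycle. *)
Lemma reduced_uniq (x : T) p : path adj x p -> reduced (x :: p) ->
  uniq (x :: p).
Proof.
elim: p x => [//|y p IH] x; rewrite [path _ _ _]/= => /andP[xy yp].
rewrite [reduced _]/= => /andP[xz ry]; have up := IH y yp ry.
rewrite cons_uniq up andbT; apply/negP => xp.
have [p1 [p2 e]] : exists p1 p2, y :: p = p1 ++ x :: p2.
  by case/splitPr: xp => p1 p2; exists p1, p2.
have {IH ry} {}yp : path adj x (p1 ++ x :: p2) by rewrite -e /= xy.
rewrite e in up; have {}xz : if p1 is [:: _] then False else True.
  by case: p1 e {up yp} => [|y' [|z p1]] //= [_ e]; rewrite e eqxx in xz.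
case: p1 {e xy} yp up xz => [|y' [|z p1]] //; first by rewrite /= adj_irr.
set c := [:: y', z & p1] => yp up _.
have := @adj_acyclic q T (x :: c); suff h : ucycle adj (x :: c) by move/(_ h).
apply/andP; split.
  by rewrite (_ : path.cycle _ _ = path adj x (rcons c x)) // rcons_path;
    move: yp; rewrite cat_path => /andP[-> /andP[-> _]].
move: up; rewrite cat_uniq => /and3P[uc /hasPn/(_ x (mem_head _ _)) xc _].
by rewrite cons_uniq uc andbT.
Qed.
End Reduced.

Section Nbr.
Local Open Scope classical_set_scope.
Variables (q : nat) (T : regular_tree q).
Local Notation adj := (@adj q T).

(** The neighbours of [x] other than [p], listed: their positions in the list
are the labels of the children of [x] when [p] is its parent. *)
Lemma children_exist (p x : T) : adj x p -> exists l : seq T,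
  [/\ uniq l, size l = q & forall y, (y \in l) = adj x y && (y != p)].
Proof.
move=> xp; have fA := finite_nbr x.
pose A := fset_set [set y | adj x y].
have Ap : p \in A by rewrite in_fset_set// inE.
exists (enum_fset (A `\ p)%fset); split; first exact: fset_uniq.
  have := cardfsD1 p A; rewrite Ap (card_fset_set (adj_regular x)) add1n.
  by case=> e; exact: esym.
by move=> y; rewrite in_fsetD1 in_fset_set// andbC; apply/andP/andP => -[];
  [move=> /set_mem xy ->|move=> /mem_set xy ->].
Qed.

Lemma child_map_exists : exists ch : T -> T -> 'I_q -> T,
  forall p x, adj x p -> [/\ injective (ch p x),
    forall i, adj x (ch p x i) /\ ch p x i != p &
    forall y, adj x y -> y != p -> exists i, y = ch p x i].
Proof.
suff h (px : T * T) : exists f : 'I_q -> T, adj px.2 px.1 -> [/\ injective f,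
    forall i, adj px.2 (f i) /\ f i != px.1 &
    forall y, adj px.2 y -> y != px.1 -> exists i, y = f i].
  by have [f hf] := choice h; exists (fun p x => f (p, x)) => p x /(hf (p, x)).
case: px => p x /=; have [xp|nxp] := boolP (adj x p); last by exists (fun=> x).
have [l [ul sl ml]] := children_exist xp; exists (fun i => nth x l i) => _;
  split.
- by move=> i j /eqP; rewrite nth_uniq ?sl// => /eqP/val_inj.
- by move=> i; apply/andP; rewrite -ml mem_nth// sl.
- move=> y xy yp; have yl : y \in l by rewrite ml xy.
  have il : index y l < q by apply: leq_trans (_ : size l <= q);
    rewrite ?index_mem// sl.
  by exists (Ordinal il); rewrite nth_index.
Qed.
End Nbr.

Section Model.
Variable q : nat.
Notation word := (word q).

(** Across the base edge each end is [up] of the other, so this covers that edge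
as well. *)
Definition wadj (u v : word) := (v == up u) || (u == up v).

Lemma wadj_sym u v : wadj u v = wadj v u.
Proof. by rewrite /wadj orbC. Qed.

Lemma wadj_up u : wadj u (up u).
Proof. by rewrite /wadj eqxx. Qed.

Lemma wadj_child u i : wadj u (child u i).
Proof. by rewrite /wadj up_child eqxx orbT. Qed.

Lemma wadjP u v : wadj u v -> v = up u \/ exists i, v = child u i.
Proof.
case/orP=> /eqP e; first by left.
case: (wordP v) e => [[b ->] ->|[w [i ->]]]; first by left;
  rewrite /up /= negbK.
by rewrite up_child => ->; right; exists i.
Qed.

Definition wconn (u v : word) := exists p, path wadj u p /\ last u p = v.

Lemma wconn_trans u v w : wconn u v -> wconn v w -> wconn u w.
Proof.
move=> [p [pp lp]] [p' [pp' lp']]; exists (p ++ p').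
by rewrite cat_path pp lp last_cat lp.
Qed.

Lemma wconn_sym u v : wconn u v -> wconn v u.
Proof.
move=> [p [up <-]]; exists (rev (belast u p)); split.
  by rewrite rev_path; apply: sub_path up => a b; rewrite wadj_sym.
by case: p {up} => //= a p; rewrite rev_cons last_rcons.
Qed.

Lemma wconn_all u v : wconn u v.
Proof.
have h w : wconn w (wroot q true).
  elim/word_ind: w => [[]|w i IH]; first by exists [::].
    by exists [:: wroot q true].
  by apply: (wconn_trans _ IH); exists [:: w]; rewrite /= wadj_sym wadj_child.
exact: wconn_trans (h u) (wconn_sym (h v)).
Qed.

Lemma up_neq_child (u : word) i : up u != child u i.
Proof.
case: (wordP u) => [[b ->]|[v [j ->]]].
  by apply/negP => /eqP; case; case: b.
rewrite up_child; apply/negP => /eqP /(congr1 (fun w => size w.2)) /=.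
by rewrite !size_rcons => /eqP; rewrite -addn2 -{1}[size _]addn0 eqn_add2l.
Qed.
End Model.

(** Label the children of every vertex and read words from a base edge. The
resulting map from the model tree is locally injective, so it sends a simple
path to a walk without backtracking, whose ends differ by [reduced_uniq];
hence it is injective. It is onto because its image is closed under adjacency
and the tree is connected. *)
Lemma coordinates (q : nat) (T : regular_tree q) : exists c : word q -> T,
  bijective c /\ forall u v, adj (c u) (c v) = wadj u v.
Proof.
have [ch chP] := child_map_exists T.
have [x0] := vertex0 T; have /eq_cardSP[y0 /= xy0 _] := adj_regular x0.
pose step (s : T * T) i := (s.2, ch s.1 s.2 i).
pose pos (u : word q) := foldl step (if u.1 then (x0, y0) else (y0, x0)) u.2.
pose c u := (pos u).2.
have posC u i : pos (child u i) = (c u, ch (pos u).1 (c u) i).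
  by rewrite /pos /= foldl_rcons.
have pos1 u : (pos u).1 = c (up u).
  by elim/word_ind: u => [[]|u i _] //; rewrite posC up_child.
have cC u i : c (child u i) = ch (c (up u)) (c u) i by rewrite /c posC pos1.
have aup u : adj (c u) (c (up u)).
  elim/word_ind: u => [[]|u i IH]; [by rewrite adj_sym|by []|].
  by rewrite up_child adj_sym cC; have [_ /(_ i)[]] := chP _ _ IH.
have inC u := let: And3 h _ _ := chP _ _ (aup u) in h.
have chN u := let: And3 _ h _ := chP _ _ (aup u) in h.
have chS u := let: And3 _ _ h := chP _ _ (aup u) in h.
have caw u v : wadj u v -> adj (c u) (c v).
  move=> /wadjP[->|[i ->]]; first exact: aup.
  by rewrite cC; case: (chN u i).
have loc u v w : wadj u v -> wadj u w -> c v = c w -> v = w.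
  move=> /wadjP[->|[i ->]] /wadjP[->|[j ->]] //; rewrite ?cC.
  - by move=> e; case: (chN u j) => _ /eqP; case.
  - by move=> e; case: (chN u i) => _ /eqP; case.
  - by move/inC ->.
have inj : injective c.
  move=> u v cuv; have [p [up lp]] := wconn_all u v.
  case: (shortenP up) lp => p' up' uq _ lp.
  have : reduced (map c (u :: p')).
    elim: p' {lp} u {cuv up} up' uq => [//|w p' IH] u /= /andP[uw wp']
      /andP[nu uq].
    apply/andP; split; last exact: IH.
    case: p' {IH uq} wp' nu => //= z p' /andP[wz _]; rewrite !inE !negb_or.
    move=> /and3P[_ uz _]; apply: contra uz => /eqP e; apply/eqP.
    by apply: (loc w) => //; rewrite wadj_sym.
  move=> r; have cp : path (@adj q T) (c u) (map c p').
    by rewrite path_map; apply: sub_path up' => a b /caw.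
  have := reduced_uniq cp r; case: p' lp {r up' uq cp} => //= a p' lp /andP[].
  by rewrite cuv -lp -!map_cons (map_f c (mem_last a p')).
have nbr u y : adj (c u) y -> exists2 v, y = c v & wadj u v.
  move=> uy; have [->|ny] := eqVneq y (c (up u)).
    by exists (up u) => //; exact: wadj_up.
  have [i ->] := chS u y uy ny; exists (child u i); first by rewrite cC.
  exact: wadj_child.
have sur y : exists u, c u = y.
  have [p [xp <-]] := adj_connected (c (wroot q true)) y.
  elim: p (wroot q true) xp => [|z p IH] u /=; first by exists u.
  by move=> /andP[/nbr[v -> _]]; exact: IH.
exists c; split.
  have [d dK] := choice sur; exists d => // u; exact: inj.
move=> u v; apply/idP/idP; last exact: caw.
by move=> /nbr[w /inj ->].
Qed.

(** * The boundary in coordinates, and elements of the Neretin group *)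

Section Coord.
Local Open Scope classical_set_scope.
Local Open Scope card_scope.
Variables (q : nat) (T : regular_tree q) (c : word q -> T) (d : T -> word q).
Hypotheses (cK : cancel c d) (dK : cancel d c).
Hypothesis cA : forall u v, adj (c u) (c v) = wadj u v.
Implicit Types (u v w : word q) (xi : point q).

Let cI : injective c := can_inj cK.

Lemma std_ray_inj xi : injective (fun n => c (trunc xi n)).
Proof.
by move=> m n /cI /(congr1 (fun w => size w.2)); rewrite !size_mkseq.
Qed.

Lemma std_ray_adj xi n : adj (c (trunc xi n)) (c (trunc xi n.+1)).
Proof. by rewrite cA truncS wadj_child. Qed.

Definition std_ray xi : ray T := Ray (@std_ray_inj xi) (@std_ray_adj xi).
Definition pt_end xi : ends T := end_of (std_ray xi).

Lemma pt_end_cyl u s (r : ray T) : (forall n, r n = c (wcat u (mkseq s n))) ->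
  end_of r = pt_end (cyl u s).
Proof.
move=> h; apply/end_of_eq; exists 0, (size u.2) => k.
by rewrite add0n h /= trunc_cyl.
Qed.

(** Standard rays that agree after a shift have equal names at matching
positions; comparing lengths, the shift is trivial. *)
Lemma pt_end_inj : injective pt_end.
Proof.
move=> xi xi' /end_of_eq[m [n h]].
have mn : m = n.
  have /cI /(congr1 (fun w => size w.2)) := h 0.
  by rewrite !size_mkseq !addn0.
subst n; apply: (@trunc_inj _ _ _) => k.
have /cI e := h k; have e1 := congr1 fst e; have e2 := congr1 snd e.
rewrite /trunc [xi.1]e1; congr (_, _).
by move: (congr1 (take k) e2);
  rewrite /mkseq -!map_take take_iota (minn_idPl (leq_addl _ _)).
Qed.

(** A ray that always moved up would reach the base edge, cross it, and be sent
back across it. *)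
Lemma ray_descends (r : ray T) : exists n i, d (r n.+1) = child (d (r n)) i.
Proof.
apply: contrapT => no.
have aw n : wadj (d (r n)) (d (r n.+1)) by rewrite -cA !dK; exact: ray_adj.
have upr n : d (r n.+1) = up (d (r n)).
  case: (wadjP (aw n)) => // -[i e]; case: no; by exists n, i.
have sz n : size (d (r n)).2 = size (d (r 0)).2 - n.
  elim: n => [|n IH]; first by rewrite subn0.
  rewrite upr subnS -IH; case: (wordP (d (r n))) => [[b ->]|[w [i ->]]] //.
  by rewrite up_child /= size_rcons.
set N := size (d (r 0)).2.
have e0 : (d (r N)).2 = [::] by apply/nilP; rewrite /nilp sz subnn.
have : r N.+2 = r N.
  rewrite -[LHS]dK upr upr -[RHS]dK; congr c.
  by case: (d (r N)) e0 => b t /= ->; rewrite /up /= negbK.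
by move/ray_inj/eqP; rewrite -addn2 -[X in _ == X]addn0 eqn_add2l.
Qed.

(** Once a ray moves down it goes on doing so, since a move up would be a
backtrack; from then on it spells an infinite word. *)
Lemma pt_end_sur (e : ends T) : exists xi, pt_end xi = e.
Proof.
have [r ->] := endP e; have [n0 [i0 e0]] := ray_descends r.
pose rho k := d (r (n0 + k)).
have down k : exists i, rho k.+1 = child (rho k) i.
  elim: k => [|k [i IH]]; first by exists i0; rewrite /rho addn1 addn0.
  have : wadj (rho k.+1) (rho k.+2) by rewrite /rho -cA !dK !addnS;
    exact: ray_adj.
  case/wadjP => //; rewrite [X in up X]IH up_child => /(can_inj dK)/ray_inj/eqP.
  by rewrite eqn_add2l -addn2 -[X in _ == X]addn0 eqn_add2l.
have [s hs] := choice down.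
exists (cyl (rho 0) s); apply: esym.
have h k : rho k = wcat (rho 0) (mkseq s k).
  elim: k => [|k IH]; first by rewrite wcat0.
  by rewrite mkseqS wcat_rcons -IH hs.
apply/end_of_eq; exists n0, (size (rho 0).2) => k.
by rewrite /= trunc_cyl -h dK.
Qed.

Definition end_pt (e : ends T) : point q := projT1 (cid (pt_end_sur e)).
Lemma end_ptK : cancel end_pt pt_end.
Proof. by move=> e; exact: (projT2 (cid (pt_end_sur e))). Qed.
Lemma pt_endK : cancel pt_end end_pt.
Proof. by move=> xi; apply: pt_end_inj; rewrite end_ptK. Qed.

Definition act (f : neretin T) xi := end_pt (f (pt_end xi)).

Lemma act1 xi : act 1%g xi = xi.
Proof. exact: pt_endK. Qed.

Lemma actM f g xi : act (f * g)%g xi = act f (act g xi).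
Proof. by rewrite /act end_ptK. Qed.

Lemma act_faithful f g : (forall xi, act f xi = act g xi) -> f = g.
Proof.
move=> h; apply: neretin_ext; apply/funext => e.
by have := h (end_pt e); rewrite /act end_ptK => /(can_inj end_ptK).
Qed.

(** If the forest isomorphism is, below the vertex [u], the automorphism with
portrait [a] carried below [v], then so is the induced map on the cylinder of
[u]. *)
Lemma induces_cyl (F : set T) phi (f : neretin T) u v a : induces F phi f ->
  (forall t, forest F (c (wcat u t))) ->
  (forall t i, ~ (F (c (wcat u t)) /\ F (c (child (wcat u t) i)))) ->
  (forall t, phi (c (wcat u t)) = c (wcat v (pmap a t))) ->
  forall s, act f (cyl u s) = cyl v (pseq a s).
Proof.
move=> hf fo nF hphi s.
have ri : injective (fun n => c (wcat u (mkseq s n))).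
  by move=> m n /cI/wcat_inj /(congr1 size); rewrite !size_mkseq.
have aw n : adj (c (wcat u (mkseq s n))) (c (wcat u (mkseq s n.+1))).
  by rewrite cA mkseqS wcat_rcons wadj_child.
have := hf (Ray ri aw); case.
  by move=> n; split; [exact: fo|split=> //=; rewrite mkseqS wcat_rcons;
    exact: nF].
move=> r rE; rewrite (@pt_end_cyl u s)// => e.
rewrite /act e (@pt_end_cyl v (pseq a s)) ?pt_endK// => n.
by rewrite rE /= hphi pmap_mkseq.
Qed.

(** Images of cofinal rays under a map of vertices are cofinal. *)
Lemma induces_exists (F1 F2 : set T) (phi : T -> T) : finite_set F1 ->
  forest_iso F1 F2 phi ->
  exists f : ends T -> ends T, induces F1 phi f.
Proof.
move=> fF iphi.
have : forall e : ends T, exists e',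
    forall r, forest_ray F1 r -> e = end_of r ->
    exists2 s : ray T, (forall n, s n = phi (r n)) & e' = end_of s.
  move=> e; have [r fr er] := end_forest_ray e fF.
  have [s sE _] := iso_ray iphi fr; exists (end_of s) => r' fr' er'.
  have [s' s'E _] := iso_ray iphi fr'; exists s' => //.
  move: er'; rewrite er => /end_of_eq[m [n h]].
  by apply/end_of_eq; exists m, n => k; rewrite sE s'E h.
by case/choice => f hf; exists f => r fr; exact: hf.
Qed.

(** Every finite set [I] of words closed under passing to the parent is the set
of internal vertices of a finite regular subtree, its [hull]: add the
children of the words in [I] and the base edge. *)
Section Hull.
Variables (I : pred (word q)) (N : nat).
Hypotheses (q_gt0 : 0 < q) (I_size : forall w, I w -> size w.2 < N).
Hypothesis I_closed : forall w i, I (child w i) -> I w.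

Definition hull : pred (word q) := [pred w | (w.2 == [::]) || I (up w)].
Definition hullT : set T := [set x | hull (d x)].

Lemma hull_child w i : hull (child w i) = I w.
Proof. by rewrite /hull /= up_child -size_eq0 size_rcons. Qed.

Lemma I_hull w : I w -> hull w.
Proof.
by case: (wordP w) => [[b ->]|[v [i ->]]] //; rewrite hull_child => /I_closed.
Qed.

Lemma hull_up w : hull w -> hull (up w).
Proof.
case: (wordP w) => [[b ->]|[v [i ->]]] //; rewrite hull_child up_child;
  exact: I_hull.
Qed.

Lemma hullE w : hullT (c w) <-> hull w.
Proof. by rewrite /hullT /= cK. Qed.

Lemma hull_nbr w : ~~ I w -> hull w ->
  [set y | hullT y /\ adj (c w) y] = [set c (up w)].
Proof.
move=> nI hw; apply/seteqP; split=> y /=; last first.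
  by move=> ->; rewrite hullE cA wadj_up; split=> //; exact: hull_up.
rewrite -[y]dK hullE cA => -[hy /wadjP[->//|[i e]]].
by move: hy; rewrite e hull_child (negPf nI).
Qed.

Lemma hull_leaf w : ~~ I w -> hull w -> leaf hullT (c w).
Proof.
move=> nI hw; split; first exact/hullE.
by apply/card_eq1P; exists (c (up w)); exact: hull_nbr.
Qed.

Lemma hull_internal w : I w -> internal hullT (c w).
Proof.
move=> Iw; apply: internalI; first exact/hullE/I_hull.
move=> y; rewrite -[y]dK cA => /wadjP[->|[i ->]]; apply/hullE.
  exact/hull_up/I_hull.
by rewrite hull_child.
Qed.

Lemma hull_forest w : forest hullT (c w) <-> ~~ I w.
Proof.
split=> [fw|nI]; first by apply/negP => /hull_internal.
have [hw|] := boolP (hull w); last by move=> /negP nw; apply: forestN => /hullE.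
case=> _ h; have := card_fset_set h.
rewrite hull_nbr// (card_fset_set card_set1) => -[] e.
by move: q_gt0; rewrite -e.
Qed.

Lemma hull_regular : finite_regular_subtree hullT.
Proof.
have root_hull b : hullT (c (wroot q b)) by exact/hullE.
split.
- apply: (@sub_finite_set _ _
    [set c (b.1, val b.2) | b in [set: bool * {bseq N of 'I_q}]]).
    move=> x; rewrite -[x]dK => /hullE hx.
    have sx : size (d x).2 <= N.
      case: (wordP (d x)) hx => [[b ->]|[v [i ->]]] //.
      by rewrite hull_child size_rcons => /I_size.
    exists ((d x).1, Bseq sx) => //=; by case: (d x) sx.
  exact/finite_image/finite_finset.
- by exists (c (wroot q true)).
- apply: (con_hub (root_hull true)) => y; rewrite -[y]dK => /hullE.
  elim/word_ind: (d y) => [b _|u i IH].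
    case: b; first by exists [::].
    exists [:: c (wroot q true)]; split=> //=; first by rewrite cA wadj_up.
    by move=> z; rewrite inE => /eqP->.
  rewrite hull_child => /I_hull /[dup] hu /IH[p [pp lp pF]].
  exists (c u :: p); split=> //=; first by rewrite cA wadj_sym wadj_child.
  by move=> z; rewrite inE => /orP[/eqP->|/pF//]; exact/hullE.
- move=> x; rewrite -[x]dK => /hullE hx; have [Ix|nIx] := boolP (I (d x)).
    by right; exact: hull_internal.
  by left; exact: hull_leaf.
Qed.

Lemma hull_adj w w' : ~~ I w -> ~~ I w' ->
  forest_adj hullT (c w) (c w') <->
  (exists i, w' = child w i) \/ (exists i, w = child w' i).
Proof.
move=> nw nw'; rewrite /forest_adj cA !hullE; split.
  case=> /wadjP[e|h] nh; last by left.
  right; case: (wordP w) e nh => [[b ->] ->|[v [i ->]]]; first by case.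
  by rewrite up_child => -> _; exists i.
case=> -[i ->]; rewrite ?(wadj_sym (child _ _)) wadj_child hull_child;
  by rewrite (negPf nw, negPf nw'); split=> // -[].
Qed.

(** Off [I], adjacency in the forest is just the parent relation, so a forest
map is one that respects children. The last clause sends roots of the forest
to roots. *)
Definition forest_endo (phi : word q -> word q) := forall w, ~~ I w ->
  [/\ ~~ I (phi w), forall i, exists j, phi (child w i) = child (phi w) j &
      hull w -> hull (phi w)].

(** The two converse implications in the definition of a forest isomorphism
come from applying the direct ones to the inverse. *)
Lemma forest_endo_iso phi psi : forest_endo phi -> forest_endo psi ->
  (forall w, ~~ I w -> psi (phi w) = w) ->
  (forall w, ~~ I w -> phi (psi w) = w) ->
  forest_iso hullT hullT (fun x => c (phi (d x))).
Proof.
move=> hphi hpsi K1 K2.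
have fE x : forest hullT x <-> ~~ I (d x) by rewrite -{1}[x]dK hull_forest.
split; first split.
- by move=> x /fE /hphi[h _ _]; apply/hull_forest.
- move=> x y; rewrite !inE => /fE fx /fE fy /cI e.
  by apply: (can_inj dK); rewrite -(K1 _ fx) e K1.
- move=> y /fE fy; have [h _ _] := hpsi _ fy.
  by exists (c (psi (d y))); [exact/hull_forest|rewrite /= cK K2// dK].
- move=> x y /fE fx /fE fy.
  have [fx' cx lx] := hphi _ fx; have [fy' cy ly] := hphi _ fy.
  rewrite hull_adj// -{3}[x]dK -{3}[y]dK hull_adj//.
  split=> -[[i e]|[i e]].
  + left; have [_ /(_ i)[j e'] _] := hpsi _ fx'; exists j.
    by rewrite -(K1 _ fy) e e' K1.
  + right; have [_ /(_ i)[j e'] _] := hpsi _ fy'; exists j.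
    by rewrite -(K1 _ fx) e e' K1.
  + by left; rewrite e; exact: cx.
  + by right; rewrite e; exact: cy.
- move=> x /fE fx; have [fx' _ lx] := hphi _ fx.
  split=> [[/hullE h _]|]; last first.
    by rewrite -{1}[x]dK => -[/hullE /lx h _]; exact: hull_leaf.
  rewrite -{1}[x]dK; apply: hull_leaf => //.
  by have [_ _ /(_ h)] := hpsi _ fx'; rewrite K1.
Qed.

Lemma hull_neretin phi psi : forest_endo phi -> forest_endo psi ->
  (forall w, ~~ I w -> psi (phi w) = w) ->
  (forall w, ~~ I w -> phi (psi w) = w) ->
  exists f : neretin T, forall u v a, ~~ I u ->
    (forall t, phi (wcat u t) = wcat v (pmap a t)) ->
    forall s, act f (cyl u s) = cyl v (pseq a s).
Proof.
move=> h1 h2 K1 K2; have iso := forest_endo_iso h1 h2 K1 K2;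
  have rH := hull_regular.
have fH : finite_set hullT by case: rH.
have [f hf] := induces_exists fH iso.
have sf : spheromorphism f by exists hullT, hullT; split=> //;
  exists (fun x => c (phi (d x))).
exists (Neretin sf) => u v a nu hphi s.
have nI t : ~~ I (wcat u t).
  elim/last_ind: t => [|t i IH]; first by rewrite wcat0.
  by rewrite wcat_rcons; apply: contra IH => /I_closed.
apply: (@induces_cyl hullT (fun x => c (phi (d x)))) => //.
- by move=> t; exact/hull_forest.
- by move=> t i; rewrite !hullE hull_child => -[_]; rewrite (negPf (nI t)).
- by move=> t; rewrite cK hphi.
Qed.

(** A point is fixed as soon as the forest map fixes all vertices below some
deep enough prefix of it. *)
Lemma fixed_cyl (f : neretin T) (P : set (point q)) phi :
  (forall u v a, ~~ I u ->
    (forall t, phi (wcat u t) = wcat v (pmap a t)) ->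
    forall s, act f (cyl u s) = cyl v (pseq a s)) ->
  (forall xi, P xi -> exists2 n, N <= n &
    forall t, phi (wcat (trunc xi n) t) = wcat (trunc xi n) t) ->
  forall xi, P xi -> act f xi = xi.
Proof.
move=> hf hP xi Pxi; have [n Nn hn] := hP _ Pxi.
have [s e] := in_cyl_trunc xi n.
suff h : act f (cyl (trunc xi n) s) =
  cyl (trunc xi n) (pseq (@id_portrait q) s).
  by move: h; rewrite pseq_id -e.
apply: hf => [|t]; last by rewrite pmap_id.
by apply/negP => /I_size; rewrite size_mkseq ltnNge Nn.
Qed.
End Hull.

(** The map that applies the portrait below [u] and fixes all other vertices is
an automorphism of the forest left by the hull of the proper prefixes of [u]. *)
Lemma local_aut_exists (q_gt0 : 0 < q) u a : exists f : neretin T,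
  (forall s, act f (cyl u s) = cyl u (pseq a s)) /\
  (forall xi, ~ in_cyl u xi -> act f xi = xi).
Proof.
pose on (m : seq 'I_q -> seq 'I_q) w :=
  if wpre u w then wcat u (m (wrest u w)) else w.
have onC m t : on m (wcat u t) = wcat u (m t) by rewrite /on wpre_cat wrest_cat.
have onN m w : ~~ wpre u w -> on m w = w by rewrite /on => /negPf->.
have onK m m' w : cancel m m' -> on m' (on m w) = w.
  move=> K; have [/wpreP[t ->]|n] := boolP (wpre u w); first by rewrite !onC K.
  by rewrite !onN.
have half m : m [::] = [::] ->
    (forall t i, exists j, m (rcons t i) = rcons (m t) j) ->
    forest_endo (spre u) (on m).
  move=> m0 mS w nI; have [/wpreP[t et]|n] := boolP (wpre u w).
    rewrite {}et in nI *; rewrite onC; split.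
    - exact/not_spre/wpre_cat.
    - move=> i; have [j ej] := mS t i; exists j.
      by rewrite -!wcat_rcons onC ej.
    - case: (lastP t) => [|t' i]; first by rewrite m0.
      have [j ->] := mS t' i; rewrite !wcat_rcons !hull_child => h.
      by case/negP: (not_spre (wpre_cat u t')).
  rewrite onN//; split=> // i; exists i; apply: onN.
  apply: contra nI => /wpre_child[->|]; last by rewrite (negPf n).
  by rewrite -[X in spre _ X](up_child w i) spre_up//= -size_eq0 size_rcons.
have h1 : forest_endo (spre u) (on (pmap a)).
  by apply: half => // t i; exists (a t i); exact: pmap_rcons.
have h2 : forest_endo (spre u) (on (pmap_inv a)) by apply: half => // t i;
  exists (inv_portrait a t i); rewrite !pmap_invE pmap_rcons.
have [w _|w _|f hf] := hull_neretin q_gt0 (@spre_size q u) (@spre_child q u)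
  h1 h2.
- exact/onK/pmapK.
- exact/onK/pmap_invK.
exists f; split; first by move=> s; apply: hf => [|t];
  [exact/not_spre/wpre_refl|exact: onC].
apply: (fixed_cyl (@spre_size q u) hf) => xi nu; exists (size u.2) => // t.
apply: onN; apply/negP => h; apply: nu.
case: (wpre_comp h (wpre_cat (trunc xi (size u.2)) t)) => p.
  by apply: in_cyl_wpre p _; exact: in_cyl_trunc.
by rewrite -(wpre_anti p) ?size_mkseq//; exact: in_cyl_trunc.
Qed.

(** The hull of the proper prefixes of [u] and [v] has [u] and [v] among its
leaves, so the trees below them can be exchanged. *)
Lemma swap_exists (q_gt0 : 0 < q) u v : incomp u v -> exists f : neretin T,
  [/\ forall s, act f (cyl u s) = cyl v s, forall s, act f (cyl v s) = cyl u s &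
      forall xi, ~ in_cyl u xi -> ~ in_cyl v xi -> act f xi = xi].
Proof.
move=> uv; pose I : pred (word q) := [pred w | spre u w || spre v w].
have IN w : wpre u w || wpre v w -> ~~ I w.
  have aux x y w' : incomp x y -> wpre x w' -> ~~ (spre x w' || spre y w').
    move=> xy p; rewrite negb_or not_spre//=; apply/negP => /andP[p' _].
    by case/andP: xy => /negP[]; exact: wpre_trans p p'.
  case/orP=> p; first exact: aux.
  by rewrite /I inE orbC; apply: aux => //; rewrite incompC.
pose phi w := if wpre u w then wcat v (wrest u w) else
  if wpre v w then wcat u (wrest v w) else w.
have phiu t : phi (wcat u t) = wcat v t by rewrite /phi wpre_cat wrest_cat.
have phiv t : phi (wcat v t) = wcat u t.
  rewrite /phi wpre_cat wrest_cat; case: ifP => // /wpreP[t'] /esym e.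
  by case: (incomp_wcat uv e).
have phiN w : ~~ wpre u w -> ~~ wpre v w -> phi w = w.
  by rewrite /phi => /negPf-> /negPf->.
have cases w : [\/ exists t, w = wcat u t, exists t, w = wcat v t |
    ~~ wpre u w /\ ~~ wpre v w].
  have [/wpreP|nu] := boolP (wpre u w); first by constructor 1.
  have [/wpreP|nv] := boolP (wpre v w); first by constructor 2.
  by constructor 3.
have phiK w : phi (phi w) = w.
  by case: (cases w) => [[t ->]|[t ->]|[n1 n2]];
    rewrite ?(phiu, phiv)// !phiN// phiN.
have half : forest_endo I phi.
  have hl x t : wpre u x || wpre v x -> ~ hull I (wcat x t) \/ t = [::].
    move=> p; case: (lastP t) => [|t' i]; [by right|left].
    rewrite wcat_rcons hull_child => Iw; have := IN (wcat x t');
      rewrite Iw => h.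
    suff : false by []; apply: h; case/orP: p => p;
      rewrite (wpre_trans p (wpre_cat _ _))//.
    by rewrite orbT.
  have hl0 x : x = u \/ x = v -> hull I x.
    move=> e; rewrite /hull /=; case: eqP => //= /eqP nx.
    by case: e nx => -> nx; rewrite /I /= spre_up// orbT.
  move=> w nI; case: (cases w) => [[t ->]|[t ->]|[n1 n2]].
  - rewrite phiu; split; first by apply: IN; rewrite wpre_cat orbT.
      by move=> i; exists i; rewrite -!wcat_rcons phiu.
    by have [//||->] := hl u t; rewrite ?wpre_refl// !wcat0 => _; apply: hl0;
      right.
  - rewrite phiv; split; first by apply: IN; rewrite wpre_cat.
      by move=> i; exists i; rewrite -!wcat_rcons phiv.
    by have [//||->] := hl v t; rewrite ?wpre_refl ?orbT// !wcat0 => _;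
      apply: hl0; left.
  - rewrite phiN//; split=> // i; exists i; apply: phiN.
      apply: contra nI => /wpre_child[e|]; last by rewrite (negPf n1).
      by rewrite /I /= -(up_child w i) -e spre_up// e /= -size_eq0 size_rcons.
    apply: contra nI => /wpre_child[e|]; last by rewrite (negPf n2).
    by rewrite /I /= -(up_child w i) -e orbC spre_up// e /= -size_eq0
      size_rcons.
have I_size w : I w -> size w.2 < maxn (size u.2) (size v.2).
  by rewrite leq_max => /orP[] /spre_size ->; rewrite ?orbT.
have I_closed w i : I (child w i) -> I w.
  by case/orP=> /spre_child h; apply/orP; [left|right].
have [//|//|f hf] := hull_neretin q_gt0 I_size I_closed half half.
exists f; split.
- move=> s; rewrite -{2}[s]pseq_id; apply: hf => [|t];
  last by rewrite phiu pmap_id.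
  by apply: IN; rewrite wpre_refl.
- move=> s; rewrite -{2}[s]pseq_id; apply: hf => [|t];
  last by rewrite phiv pmap_id.
  by apply: IN; rewrite wpre_refl orbT.
move=> xi nu nv.
apply: (@fixed_cyl I _ I_size f [set xi | ~ in_cyl u xi /\ ~ in_cyl v xi] _
  hf) => //.
move=> {nu nv}xi' [nu nv]; exists (maxn (size u.2) (size v.2)) => // t.
have aux x : size x.2 <= maxn (size u.2) (size v.2) -> ~ in_cyl x xi' ->
    ~~ wpre x (wcat (trunc xi' (maxn (size u.2) (size v.2))) t).
  move=> sx nx; apply/negP => h; apply: nx.
  case: (wpre_comp h (wpre_cat _ t)) => p.
    by apply: in_cyl_wpre p _; exact: in_cyl_trunc.
  by rewrite -(wpre_anti p) ?size_mkseq//; exact: in_cyl_trunc.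
by apply: phiN; apply: aux; rewrite ?leq_maxl ?leq_maxr.
Qed.
End Coord.

(** * Spheromorphisms are piecewise similarities *)

Section Tame.
Local Open Scope classical_set_scope.
Local Open Scope card_scope.
Variables (q : nat) (T : regular_tree q) (c : word q -> T) (d : T -> word q).
Hypotheses (q_gt0 : 0 < q) (cK : cancel c d) (dK : cancel d c).
Hypothesis cA : forall u v, adj (c u) (c v) = wadj u v.
Implicit Types (u v w : word q) (xi : point q) (F : set T).
Local Notation act := (act cK dK cA).

Let cI : injective c := can_inj cK.

(** Both trees of a forest isomorphism can be grown to contain a given finite
set: grow the target first, then the source, pulling back each time. *)
Lemma enlarge_pair F1 F2 (A : set T) (f : ends T -> ends T) :
  finite_regular_subtree F1 -> finite_regular_subtree F2 -> finite_set A ->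
  induced_by_iso F1 F2 f -> exists G1 G2,
  [/\ finite_regular_subtree G1, finite_regular_subtree G2,
      induced_by_iso G1 G2 f, A `<=` G1 & A `<=` G2].
Proof.
move=> r1 r2 fA [phi [iphi hf]].
have [B [rB F2B AB]] := absorb_fin r2 fA.
have [G [rG _ h1]] := pullback r1 r2 rB F2B iphi hf.
have [g [fK gK [psi [ipsi hg]]]] := induced_inv rG rB h1.
have [B' [rB' GB' AB']] := absorb_fin rG fA.
have [G' [rG' BG' h2]] := pullback rB rG rB' GB' ipsi hg.
have [f' [K1 K2 hf']] := induced_inv rG' rB' h2.
have -> : f = f' by apply/funext => e; rewrite -[LHS]K1 fK.
by exists B', G'; split=> //; exact: subset_trans BG'.
Qed.

(** A regular subtree containing the base edge is closed under [up], so that its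
leaves are an antichain of words. *)
Definition rooted F := finite_regular_subtree F /\ forall b, F (c (wroot q b)).

(** A path inside [F] from [child w i] to the base edge can leave the set of
words below [child w i] only through [w]. *)
Lemma rooted_parent F w i : rooted F -> F (c (child w i)) -> F (c w).
Proof.
move=> [[_ _ cF _] rF] Fw; apply: contrapT => nF.
have [p [pp lp pF]] := cF _ _ Fw (rF (~~ w.1)).
have h v : wpre (child w i) v -> path (@adj q T) (c v) p ->
    {in p, forall z, F z} -> wpre (child w i) (d (last (c v) p)).
  elim: p {pp lp pF} v => [|y p IH] v wv /=; first by rewrite cK.
  rewrite -[y]dK => /andP[]; rewrite cA => vy yp pF.
  apply: IH => //; last by move=> z zp; apply: pF; rewrite inE zp orbT.
  have : F (c (d y)) by apply: pF; rewrite inE eqxx.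
  case/wadjP: vy => [->|[j -> _]]; last first.
    by apply: wpre_trans wv _; rewrite child_cat wpre_cat.
  case/wpreP: wv => t ->; case: (lastP t) => [|t' j].
    by rewrite wcat0 up_child => /nF.
  by rewrite wcat_rcons up_child => _; exact: wpre_cat.
have := h _ (wpre_refl _) pp pF.
by rewrite lp cK /wpre /=; case: (w.1).
Qed.

Lemma rooted_prefix F w t : rooted F -> F (c (wcat w t)) -> F (c w).
Proof.
move=> rF; elim/last_ind: t => [|t i IH]; first by rewrite wcat0.
by rewrite wcat_rcons => /(rooted_parent rF).
Qed.

Lemma rooted_up F w : rooted F -> F (c w) -> F (c (up w)).
Proof.
move=> rF; case: (wordP w) => [[b ->] _|[v [i ->]]]; first exact: (rF.2 (~~ b)).
by rewrite up_child; exact: rooted_parent.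
Qed.

Lemma leaf_child F w i : rooted F -> leaf F (c w) -> ~ F (c (child w i)).
Proof.
move=> rF [Fw /card_eq1P[z e]] Fi.
have h y : F y -> adj (c w) y -> y = z by move=> Fy wy;
  suff : [set z] y by []; rewrite -e.
have /cI/eqP : c (up w) = c (child w i).
  rewrite (h (c (up w))) ?cA ?wadj_up//; last exact: rooted_up.
  by rewrite (h (c (child w i))) ?cA ?wadj_child.
by rewrite (negPf (up_neq_child w i)).
Qed.

Lemma leaf_antichain F u v : rooted F -> leaf F (c u) -> leaf F (c v) ->
  wpre u v -> u = v.
Proof.
move=> rF lu [Fv _] /wpreP[[|i t] e]; first by rewrite e wcat0.
move: Fv; rewrite e -[i :: t]cat1s -wcatA -child_cat => /(rooted_prefix rF) h.
by case: (leaf_child rF lu h).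
Qed.

(** The last vertex in [F] on the standard ray of a point is a leaf of [F]. *)
Lemma leaves_complete F : rooted F -> exists2 U, complete_code U &
  forall u, u \in U <-> leaf F (c u).
Proof.
move=> rF; have [[fF _ _ dF] r0] := rF.
have /finite_seqP[l hl] : finite_set (c @^-1` F).
  by apply: finite_preimage => // ? ? _ _; exact: cI.
have lE u : u \in l <-> F (c u).
  by move: (congr1 (fun A : set _ => A u) hl) => /= ->.
pose U := undup [seq u <- l | `[< leaf F (c u) >]].
have UE u : u \in U <-> leaf F (c u).
  rewrite /U mem_undup mem_filter; split=> [/andP[/asboolP//]|lu].
  by apply/andP; split; [exact/asboolP|apply/lE; case: lu].
exists U => //; split; first exact: undup_uniq.
  move=> xi; pose r := std_ray cK cA xi; have [N hN] := ray_leaves r fF.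
  have ex : exists n, `[< ~ F (c (trunc xi n)) >] by exists N;
    apply/asboolP/(hN N).
  case: (ex_minnP ex) => -[|n] /asboolP nF min; first by case: nF; exact: r0.
  exists (trunc xi n); last exact: in_cyl_trunc.
  have Fn : F (c (trunc xi n)).
    apply: contrapT => /asboolP /min; by rewrite ltnn.
  apply/UE; case: (dF _ Fn) => // /internal_nbr; move/(_ (c (trunc xi n.+1))).
  by rewrite cA truncS wadj_child => /(_ isT); rewrite -truncS => /nF.
move=> xi u v /UE lu /UE lv iu iv; case: (in_cyl_comp iu iv) => p.
  exact: leaf_antichain rF lu lv p.
by apply/esym; exact: leaf_antichain rF lv lu p.
Qed.

Lemma leaf_below F u t : rooted F -> leaf F (c u) ->
  (forall i, ~ F (c (child (wcat u t) i))) /\ forest F (c (wcat u t)).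
Proof.
move=> rF1 lu.
have nF t' i : ~ F (c (child (wcat u t') i)).
  case: t' => [|j t']; first by rewrite wcat0; exact: leaf_child.
  rewrite -wcat_rcons rcons_cons -cat1s -wcatA -child_cat => /(rooted_prefix
    rF1).
  exact: leaf_child.
split; first exact: nF.
case: (lastP t) => [|t' i]; last by rewrite wcat_rcons; exact/forestN/nF.
rewrite wcat0 => iu; have := @nF [::] (Ordinal q_gt0); rewrite wcat0; apply.
by apply: internal_nbr iu _; rewrite cA wadj_child.
Qed.

(** Starting at a leaf [u], the image of a child can never be the parent of the
image: at [u] that edge lies in [F2], and further down it would break
injectivity. So children go to children, and injectivity makes the label map
at each vertex a permutation: this is the portrait. *)
Lemma iso_below F1 F2 phi u : rooted F1 -> rooted F2 -> forest_iso F1 F2 phi ->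
  leaf F1 (c u) ->
  exists v a, forall t, phi (c (wcat u t)) = c (wcat v (pmap a t)).
Proof.
move=> rF1 rF2 [[ff inj _] ad lf] lu.
have nF t := (leaf_below t rF1 lu).1; have fu t := (leaf_below t rF1 lu).2.
pose psi t := d (phi (c (wcat u t))).
have psiF t : forest F2 (c (psi t)) by rewrite dK; exact: ff.
have psiI t t' : psi t = psi t' -> t = t'.
  move=> /(can_inj dK) /inj e; apply: (@wcat_inj _ u); apply: cI.
  by apply: e; rewrite inE; exact: fu.
have psiA t i : wadj (psi t) (psi (rcons t i)) /\
    ~ (F2 (c (psi t)) /\ F2 (c (psi (rcons t i)))).
  have : forest_adj F1 (c (wcat u t)) (c (wcat u (rcons t i))).
    by rewrite wcat_rcons; split=> [|[_ /nF//]]; rewrite cA wadj_child.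
  by move/(ad _ _ (fu _) (fu _)); rewrite /forest_adj -cA !dK.
have l2 : leaf F2 (c (psi [::])) by rewrite dK; apply/lf;
  rewrite ?wcat0// -[u]wcat0; exact: fu.
have [J hJ] : exists J : seq 'I_q -> 'I_q -> 'I_q, forall t i,
    psi (rcons t i) = child (psi t) (J t i).
  suff h t i : exists j, psi (rcons t i) = child (psi t) j.
    have [J hJ] := choice (fun ti : seq 'I_q * 'I_q => h ti.1 ti.2).
    by exists (fun t i => J (t, i)) => t i; exact: (hJ (t, i)).
  elim/last_ind: t i => [|t j IH] i.
    have [/wadjP[e|//] n2] := psiA [::] i; case: n2; split; first by case: l2.
    by rewrite e; apply: rooted_up => //; case: l2.
  have [/wadjP[e|//] _] := psiA (rcons t j) i; move: e.
  have [k ->] := IH j; rewrite up_child => /psiI /(congr1 size).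
  by rewrite !size_rcons => /eqP; rewrite -addn2 -[X in _ == X]addn0 eqn_add2l.
have Jinj t : injective (J t).
  by move=> i j e; have := hJ t i; rewrite e -hJ => /psiI/rcons_inj[].
exists (psi [::]), (fun t => perm (@Jinj t)) => t.
rewrite -[LHS]dK; congr c; rewrite -/(psi t).
elim/last_ind: t => [|t i IH]; first by rewrite wcat0.
by rewrite hJ IH pmap_rcons wcat_rcons permE.
Qed.

(** The pieces are the cylinders of the leaves of the first tree, once both
trees contain the base edge. *)
Lemma neretin_sims (f : neretin T) : exists2 U, complete_code U &
  forall u, u \in U -> exists v a, forall s, act f (cyl u s) = cyl v (pseq a s).
Proof.
have [F1 [F2 [r1 r2 h]]] := neretinP f.
have fA : finite_set [set c (wroot q b) | b in [set: bool]].
  exact/finite_image/finite_finset.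
have [G1 [G2 [rG1 rG2 [phi [iphi hf]] A1 A2]]] := enlarge_pair r1 r2 fA h.
have R1 : rooted G1 by split=> // b; apply: A1; exists b.
have R2 : rooted G2 by split=> // b; apply: A2; exists b.
have [U cU UE] := leaves_complete R1; exists U => // u /UE lu.
have [v [a hva]] := iso_below R1 R2 iphi lu; exists v, a.
apply: (induces_cyl cK dK cA hf) => // [t|t i].
  exact: (leaf_below t R1 lu).2.
by move=> [_]; exact: (leaf_below t R1 lu).1.
Qed.
End Tame.

(** * Simplicity of groups of piecewise similarities *)

Section Abstract.
Local Open Scope group_scope.
Variables (q : nat) (G : groupType) (act : G -> point q -> point q).
Hypothesis q_ge2 : 1 < q.
Hypothesis act1 : forall xi, act 1 xi = xi.
Hypothesis actM : forall f g xi, act (f * g) xi = act f (act g xi).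
Hypothesis act_faithful : forall f g, (forall xi, act f xi = act g xi) -> f = g.
Implicit Types (u v w : word q) (xi : point q) (f g h : G) (a : portrait q)
  (U V : seq (word q)).

Definition supported f u := forall xi, ~ in_cyl u xi -> act f xi = xi.
Definition is_local_aut f u a :=
  (forall s, act f (cyl u s) = cyl u (pseq a s)) /\ supported f u.
Definition is_swap f u v :=
  [/\ forall s, act f (cyl u s) = cyl v s, forall s, act f (cyl v s) = cyl u s &
      forall xi, ~ in_cyl u xi -> ~ in_cyl v xi -> act f xi = xi].
Definition sim f u v := exists a, forall s, act f (cyl u s) = cyl v (pseq a s).
Definition sims f U :=
  forall u, u \in U -> exists v, sim f u v.

Hypothesis local_aut_ex : forall u a, exists f, is_local_aut f u a.
Hypothesis swap_ex : forall u v, incomp u v -> exists f, is_swap f u v.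
Hypothesis act_sims : forall f, exists2 U, complete_code U & sims f U.

Let o0 : 'I_q := Ordinal (ltnW q_ge2).
Let o1 : 'I_q := Ordinal q_ge2.
Let s0 : nat -> 'I_q := fun=> o0.

Lemma actK f : cancel (act f) (act f^-1).
Proof. by move=> xi; rewrite -actM mulVg act1. Qed.

Lemma actKV f : cancel (act f^-1) (act f).
Proof. by move=> xi; rewrite -actM mulgV act1. Qed.

Lemma act_inj f : injective (act f).
Proof. exact: can_inj (actK f). Qed.

Lemma actV_eq f xi xi' : act f xi = xi' -> act f^-1 xi' = xi.
Proof. by move=> <-; exact: actK. Qed.

Lemma local_aut_fix f u a v s : is_local_aut f u a -> incomp u v ->
  act f (cyl v s) = cyl v s.
Proof.
by move=> [_ h] uv; apply: h; exact: incomp_notin_cyl.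
Qed.

Lemma swap_fix f u v w s : is_swap f u v -> incomp u w -> incomp v w ->
  act f (cyl w s) = cyl w s.
Proof.
by move=> [_ _ h] uw vw; apply: h; exact: incomp_notin_cyl.
Qed.

Lemma supportedM f g u : supported f u -> supported g u -> supported (f * g) u.
Proof. by move=> hf hg xi n; rewrite actM hg// hf. Qed.

Lemma supported_in_cyl f u xi : supported f u -> in_cyl u xi ->
  in_cyl u (act f xi).
Proof.
move=> hf iu; apply: contrapT => n; have := hf _ n => /act_inj e.
by rewrite e in n.
Qed.

Lemma supportedV f u : supported f u -> supported f^-1 u.
Proof. by move=> hf xi n; apply: actV_eq; exact: hf. Qed.

Lemma swap_supported f u t t' : is_swap f (wcat u t) (wcat u t') ->
  supported f u.
Proof.
by move=> [_ _ h] xi n; apply: h => i; apply: n; apply: in_cyl_wpre i;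
  exact: wpre_cat.
Qed.

Lemma swapN1 f u v : incomp u v -> is_swap f u v -> f <> 1.
Proof.
by move=> uv [h _ _] e; move: (h s0); rewrite e act1; exact: incomp_cyl.
Qed.

(** Two words on the same side of the base edge are both incomparable to the end
of that edge on the other side, so two swaps suffice. *)
Lemma transport u v : exists f, forall s, act f (cyl u s) = cyl v s.
Proof.
have h x y : x.1 != y.1 -> exists f, forall s, act f (cyl x s) = cyl y s.
  by move=> /incomp_side/swap_ex[f [hf _ _]]; exists f.
have [e|ne] := eqVneq u.1 v.1; last exact: h.
pose z : word q := wroot q (~~ u.1).
have [f hf] : exists f, forall s, act f (cyl u s) = cyl z s by apply: h;
  rewrite /z /=; case: (u.1).
have [g hg] : exists f, forall s, act f (cyl z s) = cyl v s by apply: h;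
  rewrite -e /z /=; case: (u.1).
by exists (g * f) => s; rewrite actM hf hg.
Qed.

(** If [f] moves [xi], then on a deep enough cylinder around [xi] the values of
[f] share a long prefix with [f xi], and so avoid that cylinder. *)
Lemma displace f : f <> 1 -> exists u, forall s, ~ in_cyl u (act f (cyl u s)).
Proof.
move=> f1; have [xi nxi] : exists xi, act f xi <> xi.
  apply: contrapT => n; apply: f1; apply: act_faithful => xi; rewrite act1.
  by apply: contrapT => e; apply: n; exists xi.
have [m nm] : exists m, trunc (act f xi) m <> trunc xi m.
  apply: contrapT => n; apply: nxi; apply: trunc_inj => m.
  by apply: contrapT => e; apply: n; exists m.
have [U [_ cU _] sU] := act_sims f; have [u uU [s es]] := cU xi.
have [v [a hf]] := sU _ uU.
exists (wcat u (mkseq s m)) => s' i; apply: nm.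
have h1 : in_cyl (wcat v (mkseq (pseq a s) m)) (act f xi).
  rewrite es hf -{2}[pseq a s](scat_mkseq _ m) -cyl_cat; exact: in_cyl_cyl.
have h2 : in_cyl (wcat v (mkseq (pseq a s) m)) (act f (cyl (wcat u (mkseq s
  m)) s')).
  rewrite cyl_cat hf pseq_scat pmap_mkseq -cyl_cat; exact: in_cyl_cyl.
have h3 : in_cyl (wcat u (mkseq s m)) xi.
  rewrite es -{2}[s](scat_mkseq _ m) -cyl_cat; exact: in_cyl_cyl.
have sz (t : seq 'I_q) x : size t = m -> m <= size (wcat x t).2.
  by move=> <-; rewrite /= size_cat leq_addl.
rewrite (in_cyl_trunc_eq h1 h2) ?sz ?size_mkseq//.
by rewrite (in_cyl_trunc_eq i h3) ?sz ?size_mkseq.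
Qed.

(** The portrait that repeats [a] below every word [0...01], the empty run of
zeros included. *)
Fixpoint spine a (t : seq 'I_q) : {perm 'I_q} :=
  if t is j :: t' then
    if j == o0 then spine a t' else if j == o1 then a t' else 1
  else 1.

(** The portrait that has [a] below [10] and [spine a] below [0]. *)
Definition swindle a : portrait q := fun t =>
  match t with
  | j :: t' => if j == o0 then spine a t' else
     if t' is k :: t'' then if (j == o1) && (k == o0) then a t'' else 1 else 1
  | _ => 1
  end.

Lemma swindle0 a s : pseq (swindle a) (scat [:: o0] s) =
  scat [:: o0] (pseq (spine a) s).
Proof. by rewrite pseq_scat /= perm1. Qed.

Lemma swindle10 a s :
  pseq (swindle a) (scat [:: o1; o0] s) = scat [:: o1; o0] (pseq a s).
Proof.
by rewrite pseq_scat /= !perm1.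
Qed.

Lemma spine0 a s : pseq (spine a) (scat [:: o0] s) =
  scat [:: o0] (pseq (spine a) s).
Proof. by rewrite pseq_scat /= perm1. Qed.

Lemma spine1 a s : pseq (spine a) (scat [:: o1] s) = scat [:: o1] (pseq a s).
Proof. by rewrite pseq_scat /= perm1. Qed.

Lemma spineN a s j : j != o0 -> j != o1 ->
  pseq (spine a) (scat [:: j] s) = scat [:: j] s.
Proof.
move=> j0 j1; rewrite pseq_scat /= perm1; congr (scat [:: j] _).
rewrite -[RHS]pseq_id; congr pseq; apply/funext => t.
by rewrite /sub /= (negPf j0) (negPf j1).
Qed.

Lemma swindleN a s j : j != o0 -> (j == o1) && (s 0 == o0) = false ->
  pseq (swindle a) (scat [:: j] s) = scat [:: j] s.
Proof.
move=> j0 j1; rewrite [s]scat_cons -!scat_cat pseq_scat /= /sub /= (negPf j0)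
  j1 !perm1.
by congr (scat [:: j; s 0] _); rewrite -[RHS]pseq_id; congr pseq;
  apply/funext => t.
Qed.

(** An infinite repetition argument. The element [h] shifts the cylinders of
[10], [01], [001], ... below [u] each to the next, and [g] acts by [a] on all of
them at once; this infinite product is a single tree automorphism because the
cylinders hang along one ray. Then [h * g * h^-1] acts by [a] on all but the
first, so its quotient with [g] is [a] on the first one alone. *)
Lemma local_aut_commutator u a b : is_local_aut b (wcat u [:: o1; o0]) a ->
  exists g h, [/\ supported g u, supported h u & b = g * h * g^-1 * h^-1].
Proof.
move=> bb; pose w t := wcat u t.
have inco t t' : incomp (w t) (w t') =
  ~~ prefix t t' && ~~ prefix t' t by exact: incomp_wcatl.
have /swap_ex[s1 hs1] : incomp (w [:: o0]) (w [:: o1]) by rewrite inco.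
have /swap_ex[s2 hs2] : incomp (w [:: o1]) (w [:: o0; o0]) by rewrite inco.
have /swap_ex[s3 hs3] : incomp (w [:: o1]) (w [:: o0; o1]) by rewrite inco.
(* [s1] exchanges 0 and 1, and [s3 * s2] moves 1 to 00, 00 to 01 and 01 to 1;
   so [h] sends 0 to 00 and 10 to 01. *)
pose h := s3 * s2 * s1.
have [g hg] := local_aut_ex u (swindle a).
have sh : supported h u by do !apply: supportedM; apply: swap_supported;
  eassumption.
have h0 s : act h (cyl (w [:: o0]) s) = cyl (w [:: o0; o0]) s.
  rewrite !actM; case: (hs1) => -> _ _; case: (hs2) => -> _ _.
  by rewrite (swap_fix _ hs3) ?inco.
have h10 s : act h (cyl (w [:: o1; o0]) s) = cyl (w [:: o0; o1]) s.
  have wE t i : w [:: i & t] = wcat (w [:: i]) t by rewrite /w wcatA.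
  rewrite !actM wE cyl_cat; case: (hs1) => _ -> _; rewrite -cyl_cat -wE.
  by case: (hs2) => _ -> _; case: (hs3) => -> _ _.
have wS t t' s : cyl (w (t ++ t')) s =
  cyl (w t) (scat t' s) by rewrite -cyl_cat /w wcatA.
have wu t s : cyl (w t) s = cyl u (scat t s) by rewrite cyl_cat.
have [gu gN] := hg; have [bu bN] := bb.
exists g, h; split=> //; apply: act_faithful.
have g0 s : act g (cyl (w [:: o0]) s) = cyl (w [:: o0]) (pseq (spine a) s).
  by rewrite !wu gu swindle0.
have g10 s : act g (cyl (w [:: o1; o0]) s) = cyl (w [:: o1; o0]) (pseq a s).
  by rewrite !wu gu swindle10.
suff k xi : act g xi = act b (act h (act g (act h^-1 xi))).
  move=> xi; rewrite 3!actM; have := k (act h (act g^-1 (act h^-1 xi))).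
  by rewrite actK actKV actKV => ->.
have [[s ->]|n00] := pselect (in_cyl (w [:: o0; o0]) xi).
  rewrite -[in RHS]h0 actK g0 h0 (local_aut_fix _ bb) ?inco//.
  by rewrite (wS [:: o0] [:: o0]) g0 spine0 -wS.
have [[s ->]|n01] := pselect (in_cyl (w [:: o0; o1]) xi).
  rewrite -[in RHS]h10 actK g10 h10 (local_aut_fix _ bb) ?inco//.
  by rewrite (wS [:: o0] [:: o1]) g0 spine1 -wS.
have gfix zeta : ~ in_cyl (w [:: o1; o0]) zeta ->
    (forall s, zeta = cyl (w [:: o0]) s -> s 0 != o0 /\ s 0 != o1) ->
      act g zeta = zeta.
  move=> n10 n0; have [[s e]|nin] := pselect (in_cyl (w [:: o0]) zeta).
    have [n1 n2] := n0 s e.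
    by rewrite e g0; congr cyl;
      rewrite [in LHS](scat_cons s) spineN// -scat_cons.
  have [[s e]|] := pselect (in_cyl u zeta); last exact: gN.
  rewrite e gu; congr cyl; rewrite [in LHS](scat_cons s) swindleN -?scat_cons//.
    apply/eqP => e0; apply: nin; exists (fun n => s n.+1).
    by rewrite e wu -e0 -scat_cons.
  apply/negbTE/negP => /andP[/eqP e1 /eqP e2]; apply: n10.
  exists (fun n => s n.+2); rewrite e wu; congr cyl.
  by apply/funext => -[|[|n]].
(* Off the cylinders of 00 and 01, the images of those of 0 and 10 under [h],
   the conjugate of [g] by [h] is trivial. *)
have -> : act g (act h^-1 xi) = act h^-1 xi.
  apply: gfix => [[s]|s] e.
    by apply: n01; exists s; rewrite -h10 -e actKV.
  by case: n00; exists s; rewrite -h0 -e actKV.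
rewrite actKV; have [[s ->]|n10] := pselect (in_cyl (w [:: o1; o0]) xi).
  by rewrite bu g10.
rewrite bN//; apply: gfix => // s e; split; apply/eqP => e0.
  by apply: n00; exists (fun n => s n.+1);
    rewrite e (wS [:: o0] [:: o0]) -e0 -scat_cons.
by apply: n01; exists (fun n => s n.+1);
  rewrite e (wS [:: o0] [:: o1]) -e0 -scat_cons.
Qed.

Lemma complete_third U u v : complete_code U -> 2 < size U -> u \in U ->
  v \in U -> exists2 z, z \in U & z != u /\ z != v.
Proof.
move=> [uU _ _] sU uinU vinU; apply: contrapT => no.
have : {subset U <= [:: u; v]}.
  move=> z zU; rewrite !inE; apply: contrapT => /negP;
    rewrite negb_or => /andP n.
  by apply: no; exists z.
by move/(uniq_leq_size uU); rewrite leqNgt sU.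
Qed.

Lemma longest U u : u \in U ->
  exists2 w, w \in U & forall v, v \in U -> size v.2 <= size w.2.
Proof.
elim: U u => // x [|y U] IH u _.
  by exists x; rewrite ?mem_head// => v; rewrite inE => /eqP ->.
have [w wU hw] := IH y (mem_head _ _).
have [le|lt] := leqP (size x.2) (size w.2).
  by exists w; [rewrite inE wU orbT|move=> v; rewrite inE => /orP[/eqP->|/hw]].
exists x; first exact: mem_head.
move=> v; rewrite inE => /orP[/eqP-> //|/hw h]; exact: leq_trans h (ltnW lt).
Qed.

(** The siblings of a longest word of a complete code belong to the code: the
word of the code that covers a sibling is not longer, and not shorter because
it would also cover the longest word. *)
Lemma complete_siblings U w : complete_code U -> w \in U -> w.2 != [::] ->
  exists x, forall i, child x i \in U.
Proof.
move=> cU wU wn; have [uU ex un] := cU; have [m mU hm] := longest wU.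
case: (wordP m) => [[b e]|[x [i e]]].
  by have := hm _ wU; rewrite e leqn0 size_eq0 (negPf wn).
subst m; exists x => j; have [v vU iv] := ex (cyl (child x j) s0).
have szj : size (child x j).2 = size (child x i).2 by rewrite !size_rcons.
case: (in_cyl_comp iv (in_cyl_cyl _ _)) => p; last first.
  by rewrite (wpre_anti p) // szj hm.
have [<-//|p'] := wpre_child p.
have e : v = child x i.
  by apply: (un (cyl (child x i) s0)) => //; [rewrite child_cat cyl_cat;
    case/wpreP: p' => t ->; rewrite cyl_cat;
    exact: in_cyl_cyl|exact: in_cyl_cyl].
by have := wpre_size p'; rewrite e size_rcons ltnn.
Qed.

Lemma big_siblings U : complete_code U -> 2 < size U ->
  exists x, forall i, child x i \in U.
Proof.
move=> cU sU; apply: contrapT => no.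
have h w : w \in U -> w.2 = [::].
  move=> wU; apply/eqP/negPn/negP => wn; apply: no;
    exact: complete_siblings cU wU wn.
have : {subset U <= [:: wroot q true; wroot q false]}.
  by move=> [b t] /h /= ->; case: b; rewrite !inE eqxx ?orbT.
by case: cU => uU _ _ /(uniq_leq_size uU); rewrite leqNgt sU.
Qed.

(** The siblings of a longest word and the word covering a point on the other
side of the base edge would already be three words. *)
Lemma complete_small U : complete_code U -> size U <= 2 ->
  (forall b, wroot q b \in U) /\ (forall w, w \in U -> exists b, w = wroot q b).
Proof.
move=> cU sU; have [uU ex un] := cU.
have h w : w \in U -> w.2 = [::].
  move=> wU; apply/eqP/negPn/negP => wn;
    have [x xU] := complete_siblings cU wU wn.
  have [v vU iv] := ex (cyl (wroot q (~~ x.1)) s0).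
  have v1 : v.1 = ~~ x.1 by case: iv => s [].
  have : {subset [:: child x o0; child x o1; v] <= U}.
    by move=> y; rewrite !inE => /or3P[] /eqP->.
  move/uniq_leq_size; rewrite /= !inE negb_or => H.
  have : 3 <= size U.
    have nv i : (child x i == v) = false.
      by apply/eqP => e; move: v1; rewrite -e /=; case: (x.1).
    have n01 : (child x o0 == child x o1) = false by apply/eqP => /child_inj[].
    by apply: H; rewrite !nv n01.
  by rewrite ltnNge sU.
split=> [b|[b t] /h /= ->]; last by exists b.
have [v vU [s e]] := ex (cyl (wroot q b) s0).
suff -> : wroot q b = v by [].
by have := h _ vU; case: e => + _; case: v vU => b' t /= _ -> ->.
Qed.

Lemma sim_cyl_onto f u v : sim f u v ->
  forall s, exists s', act f (cyl u s') = cyl v s.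
Proof.
by move=> [a h] s; exists (pseq (inv_portrait a) s); rewrite h pseq_invK.
Qed.

Lemma sim_target f u v v' : sim f u v -> sim f u v' -> v = v'.
Proof.
have h x y : sim f u x -> sim f u y -> wpre x y.
  move=> [a hx] hy; apply: (cyl_subset q_ge2) => s.
  have [s' <-] := sim_cyl_onto hy s; rewrite hx; exact: in_cyl_cyl.
by move=> h1 h2; apply: wpre_anti; [|apply: wpre_size]; exact: h.
Qed.

Lemma simM f g u v w : sim g u v -> sim f v w -> sim (f * g) u w.
Proof.
by move=> [a h] [b h']; exists (comp_portrait b a) => s;
  rewrite actM h h' pseq_comp.
Qed.

Definition exact_sim f u v := forall s, act f (cyl u s) = cyl v s.

Lemma exact_simW f u v : exact_sim f u v -> sim f u v.
Proof. by move=> h; exists (@id_portrait q) => s; rewrite pseq_id. Qed.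

(** A portrait maps onto all infinite words, so the image of a cylinder is a
whole cylinder, and the injectivity of [f] keeps the images disjoint. *)
Lemma image_complete U f : complete_code U -> sims f U ->
  exists V, [/\ complete_code V, size V = size U & forall v,
    v \in V -> exists2 u, u \in U & sim f u v].
Proof.
move=> [uU ex un] sU.
have : forall u, exists v, u \in U -> sim f u v.
  move=> u; have [/sU[v h]|] := boolP (u \in U); first by exists v.
  by exists u.
case/choice => m hm; exists (map m U).
have eqU u u' xi : u \in U -> u' \in U -> in_cyl (m u) xi ->
  in_cyl (m u') xi -> u = u'.
  move=> uU' uU'' [s e] [s' e'].
  have [r hr] := sim_cyl_onto (hm _ uU') s;
    have [r' hr'] := sim_cyl_onto (hm _ uU'') s'.
  apply: (un (cyl u r)) => //; first exact: in_cyl_cyl.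
  by exists r'; apply: (@act_inj f); rewrite hr hr' -e -e'.
split; last 1 first.
- by move=> v /mapP[u uinU ->]; exists u => //; exact: hm.
- split.
  + rewrite map_inj_in_uniq// => u u' uinU u'inU e.
    by apply: (eqU u u' (cyl (m u) s0)) => //; rewrite -?e; exact: in_cyl_cyl.
  + move=> xi; have [u uinU [s e]] := ex (act f^-1 xi).
    exists (m u); first exact: map_f.
    have [a h] := hm _ uinU; exists (pseq a s).
    by rewrite -h -e actKV.
  + move=> xi v v' /mapP[u uinU ->] /mapP[u' u'inU ->] i i'.
    by rewrite (eqU u u' xi).
- exact: size_map.
Qed.

(** A subgroup [K] that contains the local automorphisms and the swaps of two
cylinders that do not cover the boundary is everything. *)
Section Generation.
Variable K : G -> Prop.
Hypotheses (K1 : K 1) (KM : forall x y, K x -> K y -> K (x * y))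
  (KV : forall x, K x -> K x^-1).
Hypothesis K_local_aut : forall f u a, is_local_aut f u a -> K f.
Hypothesis K_swap : forall f u v z, is_swap f u v -> incomp u v -> incomp z u ->
  incomp z v -> K f.

(** The elements that permute the pieces of [U]: composing with them on the
right keeps the partition [U] and the target cylinders. *)
Definition permutes U h :=
  (forall u, u \in U -> exists2 v, v \in U & sim h u v) /\
  (forall v, v \in U -> exists2 u, u \in U & sim h u v).

Lemma permutesM U g h : permutes U g -> permutes U h -> permutes U (g * h).
Proof.
move=> [g1 g2] [h1 h2]; split.
  move=> u /h1[v /g1[w wU hw] hv]; exists w => //; exact: simM hv hw.
by move=> w /g2[v /h2[u uU hu] hv]; exists u => //; exact: simM hu hv.
Qed.

Lemma permutes1 U : permutes U 1.
Proof.
by split=> u uU; exists u => //; apply: exact_simW => s; rewrite act1.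
Qed.

(** Swap [u] with the piece [u'] that is sent to [v], then straighten the map on
[u] by a local automorphism. *)
Lemma place_one U f u u' v : complete_code U -> 2 < size U ->
  u \in U -> u' \in U ->
  sim f u' v ->
  exists h, [/\ K h, permutes U h, exact_sim (f * h) u v &
    forall w, w \in U -> w != u -> w != u' -> exact_sim h w w].
Proof.
move=> cU sU uU u'U hv.
have inco x y : x \in U -> y \in U -> x != y -> incomp x y.
  exact: complete_incomp o0 cU.
suff [h [Kh Ph [a ha] hfix]] :
    exists h, [/\ K h, permutes U h, sim (f * h) u v &
    forall w, w \in U -> w != u -> w != u' -> exact_sim h w w].
  have [b bb] := local_aut_ex u (inv_portrait a); have [bu bN] := bb.
  have bw w : w \in U -> w != u -> exact_sim b w w.
    by move=> wU wu s; apply: local_aut_fix bb _; apply: inco => //;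
      rewrite eq_sym.
  exists (h * b); split.
  - by apply: KM => //; exact: K_local_aut bb.
  - apply: permutesM => //.
    have bU w : w \in U -> sim b w w.
      by have [->|wu wU] := eqVneq w u;
        [exists (inv_portrait a)|exact/exact_simW/bw].
    by split=> w wU; exists w => //; exact: bU.
  - by move=> s; rewrite mulgA actM bu ha pseq_invK.
  - by move=> w wU wu wu' s; rewrite actM bw// hfix.
have [e|uu'] := eqVneq u u'.
  exists 1; split=> //; first exact: permutes1; first by rewrite mulg1 e.
  by move=> w _ _ _ s; rewrite act1.
have [h hh] := swap_ex (inco _ _ uU u'U uu'); have [h1 h2 h3] := hh.
have [z zU [zu zu']] := complete_third cU sU uU u'U.
have hw w : w \in U -> w != u -> w != u' -> exact_sim h w w.
  by move=> wU wu wu' s; apply: swap_fix hh _ _; apply: inco => //;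
    rewrite eq_sym.
exists h; split=> //.
- by apply: K_swap hh _ _ _; [exact: inco|exact: (inco z)|exact: inco].
- have ex w : w \in U -> exists2 w', w' \in U & sim h w w' /\ sim h w' w.
    move=> wU; have [->|wu] := eqVneq w u.
      by exists u' => //; split; exact: exact_simW.
    have [->|wu'] := eqVneq w u'; first by exists u => //; split;
      exact: exact_simW.
    by exists w => //; split; exact/exact_simW/hw.
  by split=> w /ex[w' w'U []]; exists w'.
- exact: simM (exact_simW h1) hv.
Qed.

(** Placing the pieces [us] one at a time: the placed ones stay put because a
target already used is not used again. *)
Lemma arrange U f us vs : complete_code U -> 2 < size U -> size us = size vs ->
  uniq us -> uniq vs -> {subset us <= U} ->
  (forall v, v \in vs -> exists2 u, u \in U & sim f u v) ->
  exists h, [/\ K h, permutes U h &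
    forall i, i < size us ->
      exact_sim (f * h) (nth (wroot q true) us i) (nth (wroot q true) vs i)].
Proof.
move=> cU sU sz uus uvs usU cov; pose x0 := wroot q true.
suff h k : k <= size us -> exists h, [/\ K h, permutes U h &
    forall i, i < k -> exact_sim (f * h) (nth x0 us i) (nth x0 vs i)].
  by have [h' [? ? ?]] := h _ (leqnn _); exists h'.
elim: k => [_|k IH kus]; first by exists 1; split=> //; exact: permutes1.
have [h [Kh Ph hk]] := IH (ltnW kus).
set u := nth x0 us k; set v := nth x0 vs k.
have uU : u \in U by apply: usU; exact: mem_nth.
have [w wU fw] : exists2 w, w \in U & sim f w v by apply: cov;
  rewrite mem_nth// -sz.
have [u' u'U hu'] := Ph.2 _ wU.
have [g [Kg Pg gu gfix]] := place_one cU sU uU u'U (simM hu' fw).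
exists (h * g); split; [exact: KM|exact: permutesM|] => i.
rewrite ltnS leq_eqVlt => /orP[/eqP->|ik]; first by rewrite mulgA.
have ius : i < size us := ltn_trans ik kus.
rewrite mulgA => s; rewrite actM gfix ?hk//.
- by apply: usU; exact: mem_nth.
- by rewrite nth_uniq// neq_ltn ik.
- apply/eqP => e; have := sim_target (exact_simW (hk _ ik)).
  rewrite e => /(_ _ (simM hu' fw)) /eqP.
  by rewrite nth_uniq -?sz// (ltn_eqF ik).
Qed.

Definition family x : seq (word q) := [seq child x i | i <- enum 'I_q].

Lemma size_family x : size (family x) = q.
Proof. by rewrite size_map size_enum_ord. Qed.

Lemma family_uniq x : uniq (family x).
Proof. by rewrite map_inj_uniq ?enum_uniq// => i j /child_inj[]. Qed.

Lemma nth_family x (i : 'I_q) : nth (wroot q true) (family x) i = child x i.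
Proof. by rewrite (nth_map i) ?size_enum_ord// nth_ord_enum. Qed.

Lemma exact_family f x y :
  (forall i : 'I_q, exact_sim f (child x i) (child y i)) -> exact_sim f x y.
Proof. by move=> h s; rewrite cyl_scons h [RHS]cyl_scons. Qed.

(** The swap of the two halves of the boundary is not among the assumed elements
of [K], because the halves cover everything. Cutting each half into the
cylinders of its children gives enough pieces for [arrange], which then undoes
[f] piece by piece. *)
Lemma K_permutes_roots f :
  (forall b, exists b', sim f (wroot q b') (wroot q b)) -> K f.
Proof.
move=> hf; pose U := family (wroot q true) ++ family (wroot q false).
have UE b i : child (wroot q b) i \in U.
  by rewrite mem_cat; case: b; rewrite (map_f _ (mem_enum _ _)) ?orbT.
have UP w : w \in U -> exists b i, w = child (wroot q b) i.
  by rewrite mem_cat => /orP[] /mapP[i _ ->]; [exists true|exists false];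
    exists i.
have uU : uniq U.
  rewrite cat_uniq !family_uniq /= andbT; apply/hasPn => w /mapP[i _ ->].
  by apply/mapP => -[j _ /child_inj[]].
have cU : complete_code U.
  split=> //.
    move=> [b s]; exists (child (wroot q b) (s 0)) => //.
    by rewrite (_ : (b, s) = cyl (wroot q b) s)// cyl_scons; exact: in_cyl_cyl.
  move=> xi u v /UP[b [i ->]] /UP[b' [j ->]].
  by move=> /in_cylE -> /in_cylE ->.
have sU : 2 < size U.
  by rewrite size_cat !size_family; exact: leq_trans (leq_add q_ge2 q_ge2).
have [h [Kh Ph hh]] : exists h, [/\ K h, permutes U h &
    forall i, i < size U ->
      exact_sim (f * h) (nth (wroot q true) U i) (nth (wroot q true) U i)].
  apply: arrange => // v /UP[b [i ->]].
  have [b0 [a h0]] := hf b.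
  exists (child (wroot q b0) ((a [::])^-1 i)) => //.
  exists (sub a [:: (a [::])^-1 i]) => s.
  by rewrite child_cat cyl_cat h0 pseq_scat child_cat cyl_cat /= permKV.
have : f * h = 1.
  apply: act_faithful => xi; have [_ ex _] := cU; have [u uin [s ->]] := ex xi.
  by rewrite act1 -(nth_index (wroot q true) uin) hh// index_mem.
by move/(canRL (mulgK _)); rewrite mul1g => ->; exact: KV.
Qed.

(** A piece below [x] must be one of the children of [x], because these already
cover the cylinder of [x]; and there are at least two of them, so that the code
shrinks. *)
Lemma coarsen U x : complete_code U -> (forall i, child x i \in U) ->
  complete_code (x :: [seq u <- U | ~~ wpre x u]) /\
  size (x :: [seq u <- U | ~~ wpre x u]) < size U.
Proof.
move=> [uU ex un] xU; split; first split.
- by rewrite /= mem_filter wpre_refl filter_uniq.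
- move=> xi; have [u uin iu] := ex xi; have [p|n] := boolP (wpre x u).
    by exists x; rewrite ?mem_head//; exact: in_cyl_wpre p iu.
  by exists u => //; rewrite inE mem_filter n uin orbT.
- move=> xi u v.
  have aux w : w \in [seq u <- U | ~~ wpre x u] -> in_cyl x xi ->
    in_cyl w xi -> False.
    rewrite mem_filter => /andP[/negP n wU] [s e] iw; apply: n.
    rewrite (un xi w (child x (s 0)))//; first by rewrite child_cat wpre_cat.
    by rewrite e cyl_scons; exact: in_cyl_cyl.
  rewrite !inE => /orP[/eqP->|uin] /orP[/eqP->|vin] // iu iv.
  + by case: (aux v).
  + by case: (aux u).
  + by move: uin vin; rewrite !mem_filter => /andP[_ uin] /andP[_ vin];
    exact: (un xi).
rewrite /= size_filter -(count_predC (wpre x) U) -[X in X < _]add1n ltn_add2r.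
rewrite -size_filter; apply: (@uniq_leq_size _ [:: child x o0; child x o1]).
  by rewrite /= inE andbT; apply/eqP => /child_inj[].
by move=> w; rewrite !inE mem_filter => /orP[] /eqP->;
  rewrite xU child_cat wpre_cat.
Qed.

(** Induction on the number of pieces. Both the source partition and the target
partition contain a full family of siblings. After an arrangement, [f] sends
the first family to the second label by label, hence the parent's cylinder to
the parent's cylinder, and the families merge. *)
Lemma generated f : K f.
Proof.
have [U cU sU] := act_sims f.
have [n] := ubnP (size U); elim: n => // n IH in U f cU sU *;
  rewrite ltnS => Un.
have [V [cV sV Vf]] := image_complete cU sU.
have [small|big] := leqP (size U) 2.
  apply: K_permutes_roots => b; have [|rV _] := complete_small cV;
    first by rewrite sV.
  have [u uU fu] := Vf _ (rV b).
  by have [_ /(_ _ uU)[b' e]] := complete_small cU small; exists b'; rewrite -e.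
have [x xU] := big_siblings cU big.
have [|y yV] := big_siblings cV; first by rewrite sV.
have [||v|h [Kh Ph hh]] :=
  arrange cU big _ (family_uniq x) (family_uniq y) _ (f := f).
- by rewrite !size_family.
- by move=> u /mapP[i _ ->].
- by move=> /mapP[i _ ->]; exact: Vf.
have fh : exact_sim (f * h) x y.
  apply: exact_family => i; have := hh i; rewrite size_family !nth_family;
    exact.
suff : K (f * h) by move=> /KM/(_ (KV Kh)); rewrite mulgK.
have [cU' ltU'] := coarsen cU xU.
apply: IH cU' _ (leq_trans ltU' Un) => u; rewrite inE => /orP[/eqP->|].
  by exists y; exact: exact_simW.
rewrite mem_filter => /andP[_ /Ph.1[u' /sU[v fv] hu]].
by exists v; exact: simM hu fv.
Qed.
End Generation.

Section Normal.
Variable K : G -> Prop.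
Hypotheses (K1 : K 1) (KM : forall x y, K x -> K y -> K (x * y))
  (KV : forall x, K x -> K x^-1) (KJ : forall y x, K x -> K (y * x * y^-1)).

(** The conjugate of [f^-1] by [k] is supported away from [u]. So [f] times it,
which lies in [K], has the same commutator with [g] as [f] has. *)
Lemma displaced_commutator k u f g : K k ->
  (forall s, ~ in_cyl u (act k (cyl u s))) ->
  supported f u -> supported g u -> K (f * g * f^-1 * g^-1).
Proof.
move=> Kk ku sf sg; pose f' := k * f^-1 * k^-1.
have f'fix s : act f' (cyl u s) = cyl u s.
  rewrite !actM (_ : act f^-1 _ = act k^-1 (cyl u s)) ?actKV//.
  apply: supportedV sf _ _ => -[s' e]; apply: (ku s').
  by rewrite -e actKV; exact: in_cyl_cyl.
have comm : f' * g = g * f'.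
  apply: act_faithful => xi; rewrite [LHS]actM [RHS]actM.
  have [iu|nu] := pselect (in_cyl u xi).
    have [s e] := supported_in_cyl sg iu; have [s' e'] := iu.
    by rewrite e f'fix e' f'fix -e' e.
  rewrite (sg _ nu); have [iu|nu'] := pselect (in_cyl u (act f' xi));
    last by rewrite sg.
  have [s e] := iu; case: nu; suff -> : xi = cyl u s by exact: in_cyl_cyl.
  by apply: (@act_inj f'); rewrite f'fix.
have Kc : K (f * f') by rewrite /f' !mulgA; apply: KM; [exact: KJ|exact: KV].
clearbody f'.
suff -> : f * g * f^-1 * g^-1 = (f * f') * (g * (f * f')^-1 * g^-1).
  by apply: KM => //; apply: KJ; exact: KV.
rewrite invMg !mulgA; congr (_ * _ * _).
by rewrite -[f * f' * g]mulgA comm !mulgA mulgK.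
Qed.

(** Up to conjugation [u] is the word [10] below a cylinder that [k] moves off
itself, where the local automorphism is a commutator of elements supported in
that cylinder. *)
Lemma normal_local_aut k f u a : K k -> k <> 1 -> is_local_aut f u a -> K f.
Proof.
move=> Kk k1 [fu fN]; have [v hv] := displace k1.
have [x hx] := transport (wcat v [:: o1; o0]) u.
have bb : is_local_aut (x^-1 * f * x) (wcat v [:: o1; o0]) a.
  split=> [s|xi n]; rewrite !actM; first by rewrite hx fu; apply: actV_eq.
  rewrite fN ?actK// => -[s e]; apply: n; exists s.
  by apply: (@act_inj x); rewrite hx.
have [g [h [sg sh e]]] := local_aut_commutator bb.
have : K (x^-1 * f * x) by rewrite e; exact: displaced_commutator Kk hv _ _.
by move=> /(KJ x); rewrite !mulgA mulgV mul1g mulgK.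
Qed.

Lemma sibling_swap_local_aut f u : is_swap f (child u o0) (child u o1) ->
  is_local_aut f u (one_level (tperm o0 o1)).
Proof.
move=> [f1 f2 f3]; split=> [s|xi n]; last first.
  by apply: f3 => i; apply: n; apply: in_cyl_wpre i; rewrite child_cat wpre_cat.
rewrite [s in RHS]scat_cons pseq_one_level -cyl_cat -child_cat cyl_scons.
have [->|n0] := eqVneq (s 0) o0; first by rewrite tpermL.
have [->|n1] := eqVneq (s 0) o1; first by rewrite tpermR.
by rewrite tpermD 1?eq_sym//; apply: f3; apply: incomp_notin_cyl;
  apply: incomp_child; rewrite eq_sym.
Qed.

(** The third word [z] leaves room to conjugate the swap of [u] and [v] to the
swap of two children of [z], which is a local automorphism at [z]. *)
Lemma normal_swap k f u v z : K k -> k <> 1 -> is_swap f u v -> incomp u v ->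
  incomp z u -> incomp z v -> K f.
Proof.
move=> Kk k1 hf uv zu zv.
have zc i w : incomp z w -> incomp (child z i) w.
  by move=> zw; rewrite child_cat -[w]wcat0; exact: incomp_cat.
have z01 : incomp (child z o0) (child z o1) by exact: incomp_child.
have [x hx] : exists x, is_swap x u (child z o0) by apply: swap_ex;
  rewrite incompC zc.
have [y hy] : exists y, is_swap y v (child z o1) by apply: swap_ex;
  rewrite incompC zc.
have [x1 x2 x3] := hx; have [y1 y2 y3] := hy; have [f1 f2 f3] := hf.
have xy1 s : act (y * x) (cyl u s) = cyl (child z o0) s.
  by rewrite actM x1 (swap_fix _ hy)// incompC// zc.
have xy2 s : act (y * x) (cyl v s) = cyl (child z o1) s.
  by rewrite actM (swap_fix _ hx) ?y1// zc.
have hs : is_swap (y * x * f * (y * x)^-1) (child z o0) (child z o1).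
  split=> [s|s|xi n0 n1]; rewrite 2!actM.
  - by rewrite -xy1 actK f1 xy2.
  - by rewrite -xy2 actK f2 xy1.
  - rewrite f3 ?actKV// => -[s e].
      by apply: n0; exists s; rewrite -xy1 -e actKV.
    by apply: n1; exists s; rewrite -xy2 -e actKV.
move: (y * x) hs => w hs.
clear xy1 xy2; have /(KJ w^-1) :=
  normal_local_aut Kk k1 (sibling_swap_local_aut hs).
by rewrite invgK !mulgA mulVg mul1g mulgKV.
Qed.

Lemma normal_full k : K k -> k <> 1 -> forall f, K f.
Proof.
move=> Kk k1; apply: generated => //.
  by move=> f u a; exact: normal_local_aut Kk k1.
by move=> f u v z; exact: normal_swap Kk k1.
Qed.
End Normal.

Lemma nontrivial : exists f, f <> 1.
Proof.
have i : incomp (wroot q true) (wroot q false) by exact: incomp_side.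
by have [f hf] := swap_ex i; exists f; exact: swapN1 i hf.
Qed.

Theorem piecewise_simple : simple_group G.
Proof.
split; first exact: nontrivial.
move=> K [[K1 KD] KJ].
have K1' : K 1 by move: K1; rewrite inE.
have KD' x y : K x -> K y -> K (x * y^-1).
  by move=> Kx Ky; have := KD x y; rewrite !inE; exact.
have KV x : K x -> K x^-1 by move=> Kx; have := KD' _ _ K1' Kx;
  rewrite /= mul1g.
have [[k [Kk k1]]|no] := pselect (exists k, K k /\ k <> 1).
  right; apply/seteqP; split=> // f _; apply: (normal_full K1' _ KV _ Kk k1).
    by move=> x y Kx /KV Ky; have := KD' _ _ Kx Ky; rewrite invgK.
  by move=> y x /(KJ _ y^-1); rewrite /conjg invgK !mulgA.
left; apply/seteqP; split=> x /=; last by move->.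
by move=> Kx; apply: contrapT => x1; apply: no; exists x.
Qed.
End Abstract.

(** * The Neretin group *)

Theorem theorem7p4 (q : nat) (hq : 2 <= q) (T : regular_tree q) :
  simple_group (neretin T).
Proof.
have [c [[d cK dK] cA]] := coordinates T; have q0 : 0 < q := ltnW hq.
apply: (@piecewise_simple q (neretin T) (act cK dK cA)) => //.
- exact: act1.
- exact: actM.
- exact: act_faithful.
- exact: local_aut_exists.
- exact: swap_exists.
- exact: neretin_sims.
Qed.
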